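(* Let $\epsilon,\alpha,\Lambda_0,\Lambda_1>0$ be positive real numbers with $\Lambda_0<\Lambda_1$. Then there are a positive integer $r_0=r_0(\Lambda_0,\Lambda_1,\epsilon,\alpha)$ and a real $\theta_0=\theta_0(\Lambda_0,\Lambda_1,\epsilon,\alpha)>0$ (depending only on $\Lambda_0,\Lambda_1,\epsilon,\alpha$) with the following property: let $\{\mathcal{M}_n\}_{n\in N}$ be a $(\Lambda_0,\Lambda_1)$-bounded matrix model that has an order $r$ expansion $$\mathbb{E}_{M\in\mathcal{M}_n}[\mathrm{Trace}(M^k)]=c_0(k)+c_1(k)/n+\cdots+c_{r-1}(k)/n^{r-1}+O(c_r(k))/n^r$$ for some $r\ge r_0$, and let $L_r$ be the set of larger bases (with respect to $\Lambda_0$) of $c_0(k),\ldots,c_{r-1}(k)$. Then for any $\theta\le\theta_0$, $$\mathbb{E}\mathrm{out}_{\mathcal{M}_n}\bigl[B_{\Lambda_0+\epsilon}(0)\cup B_{n^{-\theta}}(L_r)\bigr]\le n^{-\alpha}$$ for $n\in N$ sufficiently large.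
   Context: Notation. $\mathbb{N}$ is the set of positive integers. For real $\rho\ge 0$ and $z\in\mathbb{C}$, $B_\rho(z)=\{x\in\mathbb{C}: |x-z|\le\rho\}$; for $L\subset\mathbb{C}$, $B_\rho(L)=\bigcup_{\ell\in L}B_\rho(\ell)$. Real intervals are viewed as subsets of $\mathbb{C}$. All probability spaces are finite with every atom of positive probability. For a probability space $\mathcal{M}$ of square matrices and $R\subset\mathbb{C}$, $\mathbb{E}\mathrm{out}_{\mathcal{M}}[R]$ is the expected number of eigenvalues of $M\in\mathcal{M}$, counted with multiplicity, that do not lie in $R$. Polyexponentials. A function $Q:\mathbb{N}\to\mathbb{C}$ is polyexponential if $Q(k)=\sum_{\ell\in L}p_\ell(k)\ell^k$ with $L\subset\mathbb{C}$ finite and $p_\ell$ polynomials, where for $\ell=0$ the expression $p_\ell(k)\ell^k$ means any function vanishing for $k$ sufficiently large. The representation is unique if $L$ is minimal (only nonzero terms are kept); the minimal $L$ is the set of bases of $Q$. A function $f:\mathbb{N}\to\mathbb{C}$ is of growth $\rho$ ($\rho\in\mathbb{R}$) if for every $\epsilon>0$, $|f(k)|<(\rho+\epsilon)^k$ for $k$ sufficiently large. An approximate polyexponential with error growth $\rho$ is a function $Q=f+g$ with $f$ polyexponential and $g$ of growth $\rho$; $f,g$ are uniquely determined if one insists that all bases of $f$ have absolute value greater than $\rho$; the bases of this $f$ are the larger bases of $Q$ with respect to $\rho$. Matrix models. Let $0<\Lambda_0<\Lambda_1$. A $(\Lambda_0,\Lambda_1)$-bounded matrix model is a collection of finite probability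 spaces $\{\mathcal{M}_n\}_{n\in N}$, with $N\subset\mathbb{N}$ infinite, where the atoms of $\mathcal{M}_n$ are $n\times n$ real-valued matrices whose eigenvalues lie in $B_{\Lambda_0}(0)\cup[-\Lambda_1,\Lambda_1]\subset\mathbb{C}$. For an integer $r\ge 0$ the model has an order $r$ expansion if, for some $K:\mathbb{N}\to\mathbb{N}$ with $K(n)/\log n\to\infty$ as $n\to\infty$, $$\mathbb{E}_{M\in\mathcal{M}_n}[\mathrm{Trace}(M^k)]=c_0(k)+c_1(k)/n+\cdots+c_{r-1}(k)/n^{r-1}+O(c_r(k))/n^r$$ for all $n\in N$ and integers $k$ with $1\le k\le K(n)$, where (1) $c_r$ is of growth $\Lambda_1$; (2) the constant in $O(c_r(k))$ is independent of $k$ and $n$; (3) for $0\le i<r$, $c_i$ is an approximate polyexponential with error growth $\Lambda_0$ whose larger bases (with respect to $\Lambda_0$) lie in $[-\Lambda_1,\Lambda_1]$. $L_r$ is the union over $0\le i\le r-1$ of the sets of larger bases of $c_i$ (with respect to $\Lambda_0$). *)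

(* Defs.v *)
From HB Require Import structures.
From mathcomp Require Import all_boot all_order all_algebra finmap.
From mathcomp Require Import all_classical all_reals all_analysis.
From mathcomp Require Import complex.
Set Implicit Arguments.
Unset Strict Implicit.
Unset Printing Implicit Defensive.
Import Order.TTheory GRing.Theory Num.Theory.
Import numFieldNormedType.Exports.
Local Open Scope classical_set_scope.
Local Open Scope complex_scope.
Local Open Scope ring_scope.

(* Sequences indexed by the positive integers are functions on nat whose value
   at 0 is never used. The norm `|z| of z : R[i] and the order on R[i] are
   R[i]-valued, so a real bound x is written x%:C; z <= x%:C and z < x%:C then
   force z to be real. *)

Definition cball (R : realType) (rho : R) (z : R[i]) : set R[i] :=
  [set x | `|x - z| <= rho%:C].

Definition cball_set (R : realType) (rho : R) (L : set R[i]) : set R[i] :=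
  \bigcup_(l in L) cball rho l.

Definition real_segment (R : realType) (a b : R) : set R[i] :=
  [set x%:C | x in [set x : R | a <= x <= b]].

(** * Finite probability spaces of matrices *)

Record matrix_space (R : realType) (n : nat) := MatrixSpace {
  atoms : {fset 'M[R]_n};
  prob : 'M[R]_n -> R;
  prob_gt0 : forall A, A \in atoms -> 0 < prob A;
  prob_sum1 : \sum_(A <- atoms) prob A = 1 }.

Definition expect (R : realType) (n : nat) (M : matrix_space R n)
    (f : 'M[R]_n -> R) : R :=
  \sum_(A <- atoms M) prob M A * f A.

Definition cmx (R : realType) (n : nat) (A : 'M[R]_n) : 'M[R[i]]_n :=
  map_mx (real_complex R) A.

(* The roots in R[i] of the characteristic polynomial, each listed as many times
   as its multiplicity. *)
Definition eigenvalues (R : realType) (n : nat) (A : 'M[R]_n) : seq R[i] :=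
  sval (closed_field_poly_normal (char_poly (cmx A))).

Definition Eout (R : realType) (n : nat) (M : matrix_space R n)
    (S : set R[i]) : R :=
  expect M (fun A => (count [pred z | z \notin S] (eigenvalues A))%:R).

(** * Polyexponentials *)

(* The functions that "p(k) l^k" may stand for. *)
Definition polyexp_term (R : realType) (l : R[i]) (t : nat -> R[i]) : Prop :=
  if l == 0 then \forall k \near \oo, t k = 0
  else exists p : {poly R[i]}, forall k, (0 < k)%N -> t k = p.[k%:R] * l ^+ k.

Definition polyexp_over (R : realType) (L : {fset R[i]}) (Q : nat -> R[i]) :
    Prop :=
  exists t : R[i] -> nat -> R[i],
    (forall l, l \in L -> polyexp_term l (t l)) /\
    (forall k, (0 < k)%N -> Q k = \sum_(l <- L) t l k).

Definition polyexp (R : realType) (Q : nat -> R[i]) : Prop :=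
  exists L, polyexp_over L Q.

Definition is_bases (R : realType) (Q : nat -> R[i]) (L : {fset R[i]}) : Prop :=
  polyexp_over L Q /\ forall L', (L' `<` L)%fset -> ~ polyexp_over L' Q.

Definition growth (R : realType) (rho : R) (f : nat -> R[i]) : Prop :=
  forall eps : R, 0 < eps ->
    \forall k \near \oo, `|f k| < ((rho + eps) ^+ k)%:C.

Definition approx_polyexp (R : realType) (rho : R) (Q : nat -> R[i]) : Prop :=
  exists f g : nat -> R[i],
    [/\ forall k, (0 < k)%N -> Q k = f k + g k, polyexp f & growth rho g].

(* L is the set of bases of f in the decomposition Q = f + g where all the bases
   of f have absolute value greater than rho. *)
Definition is_larger_bases (R : realType) (rho : R) (Q : nat -> R[i])
    (L : {fset R[i]}) : Prop :=
  exists f g : nat -> R[i],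
    [/\ forall k, (0 < k)%N -> Q k = f k + g k,
        is_bases f L,
        forall l, l \in L -> rho%:C < `|l|
      & growth rho g].

(* There is at most one L with is_larger_bases rho Q L if 0 <= rho. *)
Definition larger_bases (R : realType) (rho : R) (Q : nat -> R[i]) : set R[i] :=
  [set l | exists2 L, is_larger_bases rho Q L & l \in L].

(** * Matrix models *)

(* Only the spaces M n with n in N are part of the model. *)
Definition bounded_matrix_model (R : realType) (Lambda0 Lambda1 : R)
    (N : set nat) (M : forall n, matrix_space R n) : Prop :=
  [/\ N `<=` [set n | (0 < n)%N], infinite_set N
    & forall n, N n -> forall A, A \in atoms (M n) ->
        forall z, eigenvalue (cmx A) z ->
          (cball Lambda0 0 `|` real_segment (- Lambda1) Lambda1) z].

Definition order_expansion (R : realType) (Lambda0 Lambda1 : R)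
    (N : set nat) (M : forall n, matrix_space R n)
    (r : nat) (c : nat -> nat -> R[i]) : Prop :=
  [/\ exists K : nat -> nat,
        [/\ forall n, (0 < n)%N -> (0 < K n)%N,
            ((K n)%:R / ln (n%:R : R)) @[n --> \oo] --> +oo
          & exists B : R, forall n, N n ->
              forall k, (1 <= k <= K n)%N ->
                `|(expect (M n) (fun A => \tr (A ^+ k)))%:C
                  - \sum_(i < r) c i k / n%:R ^+ i|
                <= B%:C * `|c r k| / n%:R ^+ r],
      growth Lambda1 (c r)
    & forall i, (i < r)%N ->
        approx_polyexp Lambda0 (c i) /\
        larger_bases Lambda0 (c i) `<=` real_segment (- Lambda1) Lambda1].

Definition expansion_bases (R : realType) (Lambda0 : R) (r : nat)
    (c : nat -> nat -> R[i]) : set R[i] :=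
  \bigcup_(i < r) larger_bases Lambda0 (c i).

(* Main.v *)
(* For a real polynomial V >= 0 on the real line and k even, the mean of
   Trace(M^k V(M)) controls the mean number of real eigenvalues at which x^k V(x)
   is large: the other eigenvalues have modulus at most Lambda0 and contribute
   O(n Lambda0^k).  Replacing each Trace(M^(k+j)) by its expansion, V becomes a
   difference operator in k acting on the c_i; a factor (X - l)^e annihilates
   p(k) l^k as soon as deg p < e.  All of this is evaluated at k ~ 2 C log n, so
   that a^k is a power of n and polynomials in k are n^o(1).

   Exponents independent of the model are available because the polynomial p_(i,l)
   attached to a base l in c_i has degree at most 2 i + 1, at least for
   |l| >= Lambda0 + eps/2 and i small with respect to r.  Take
   V_j = (X - l)^(2j) W, where W vanishes to a high order at the other bases, and
   let u_j be the normalized mean of Trace(M^k V_j(M)).  If the claim holds below i,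
   then u_i = O(n^(-i + o(1))), whereas u_(i+J) is negligible for J large, since
   V_(i+J) annihilates every base.  Interpolating between the two,
   (x - l)^2 <= T + T^(1-J) (x - l)^(2J), makes u_(i+1) smaller than n^(-i) by a
   power of n, and this is only possible if V_(i+1) annihilates p_(i,l).

   The theorem then follows with V = prod (X - l)^(2m) over the larger bases,
   because V(x) >= c n^(-2 m theta) outside the n^(-theta)-neighbourhood of the
   bases: x is close to at most one of them. *)

Require Import Defs.
From mathcomp Require Import all_boot all_order all_algebra finmap.
From mathcomp Require Import all_classical all_reals all_analysis.
From mathcomp Require Import complex.
From mathcomp Require Import spectral ring lra.
Import Order.TTheory GRing.Theory Num.Theory.
Import numFieldNormedType.Exports.
Local Open Scope classical_set_scope.
Local Open Scope ring_scope.

Set Implicit Arguments.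
Unset Strict Implicit.
Unset Printing Implicit Defensive.

(** * Traces of powers and eigenvalues *)

Lemma trig_mulmx (F : comNzRingType) (n : nat) (A B : 'M[F]_n) :
  is_trig_mx A -> is_trig_mx B ->
  is_trig_mx (A *m B) /\ forall i, (A *m B) i i = A i i * B i i.
Proof.
move=> /is_trig_mxP tA /is_trig_mxP tB; split=> [|i].
  apply/is_trig_mxP => i j ij; rewrite mxE big1 // => k _.
  have [ik|ki] := ltnP i k; first by rewrite tA // mul0r.
  by rewrite tB ?mulr0 // (leq_ltn_trans ki).
rewrite mxE (bigD1 i) //= big1 ?addr0 // => k; rewrite neq_ltn => /orP[ki|ik].
  by rewrite tB ?mulr0.
by rewrite tA ?mul0r.
Qed.

Lemma trig_mxX (F : comNzRingType) (n k : nat) (A : 'M[F]_n) :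
  is_trig_mx A -> is_trig_mx (A ^+ k) /\ forall i, (A ^+ k) i i = A i i ^+ k.
Proof.
move=> tA; elim: k => [|k [tk dk]].
  split=> [|i]; last by rewrite !expr0 mxE eqxx.
  by rewrite expr0; apply: scalar_mx_is_trig.
have [tS dS] := trig_mulmx tA tk.
by split=> [|i]; rewrite exprS // dS dk -exprS.
Qed.

Lemma char_poly_conj (F : fieldType) (n : nat) (P A : 'M[F]_n) :
  P \in unitmx -> char_poly (P *m A *m invmx P) = char_poly A.
Proof.
move=> uP; rewrite /char_poly /char_poly_mx !map_mxM.
have cP : map_mx polyC P *m map_mx polyC (invmx P) = 1%:M.
  by rewrite -map_mxM mulmxV // map_mx1.
have -> : 'X%:M - map_mx polyC P *m map_mx polyC A *m map_mx polyC (invmx P) =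
  map_mx polyC P *m ('X%:M - map_mx polyC A) *m map_mx polyC (invmx P).
  by rewrite mulmxBr mulmxBl scalar_mxC -(mulmxA 'X%:M) cP mulmx1.
by rewrite 2!det_mulmx mulrAC -det_mulmx cP det1 mul1r.
Qed.

(** Schur triangularization: the diagonal of a power of a triangular matrix consists of the powers
    of its diagonal, and unique factorization of the characteristic polynomial matches that diagonal
    with [s] up to order. Dimension 0 is separate because [Schur] needs a positive dimension. *)
Lemma mxtrace_exp_roots (F : numClosedFieldType) (n k : nat) (A : 'M[F]_n)
    (s : seq F) : char_poly A = \prod_(z <- s) ('X - z%:P) ->
  \tr (A ^+ k) = \sum_(z <- s) z ^+ k.
Proof.
case: n A => [|n] A As.
  rewrite /mxtrace big_ord0; have : size s = 0%N.
    by apply/succn_inj; rewrite -(size_prod_XsubC _ id) -As size_char_poly.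
  by move/size0nil ->; rewrite big_nil.
have [P /unitarymx_unit uP] := Schur A isT.
rewrite /similar_to /= conjumx // => tT.
set T := P *m A *m _ in tT; have [_ dT] := trig_mxX k tT.
have Tk : \tr (T ^+ k) = \tr (A ^+ k).
  have -> : T ^+ k = P *m A ^+ k *m invmx P.
    elim: (k) => [|m IH]; first by rewrite !expr0 mulmx1 mulmxV.
    by rewrite !exprS IH /T -!mulmxE !mulmxA mulmxKV.
  by rewrite mxtrace_mulC mulmxA mulVmx // mul1mx.
rewrite -Tk /mxtrace (eq_bigr _ (fun i _ => dT i)).
have := char_poly_trig tT; rewrite char_poly_conj // As.
rewrite -(big_map (fun i => T i i) xpredT (fun x => 'X - x%:P)).
by move=> /prod_XsubC_eq ps; rewrite (perm_big _ ps) big_map.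
Qed.

Lemma char_poly_eigenvalues (R : realType) (n : nat) (A : 'M[R]_n) :
  char_poly (cmx A) = \prod_(z <- eigenvalues A) ('X - z%:P).
Proof.
rewrite /eigenvalues; case: closed_field_poly_normal => s /=.
by rewrite (monicP (char_poly_monic _)) scale1r.
Qed.

Lemma size_eigenvalues (R : realType) (n : nat) (A : 'M[R]_n) :
  size (eigenvalues A) = n.
Proof.
apply/succn_inj; rewrite -(size_prod_XsubC _ id) -char_poly_eigenvalues.
exact: size_char_poly.
Qed.

Lemma mem_eigenvalues (R : realType) (n : nat) (A : 'M[R]_n) (z : R[i]) :
  (z \in eigenvalues A) = eigenvalue (cmx A) z.
Proof.
by rewrite eigenvalue_root_char char_poly_eigenvalues root_prod_XsubC.
Qed.

Lemma mxtrace_exp_eigenvalues (R : realType) (n k : nat) (A : 'M[R]_n) :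
  (\tr (A ^+ k))%:C%C = \sum_(z <- eigenvalues A) z ^+ k.
Proof.
rewrite -(mxtrace_exp_roots _ (char_poly_eigenvalues A)).
rewrite raddf_sum /mxtrace; apply: eq_bigr => i _.
suff -> : cmx A ^+ k = cmx (A ^+ k) by rewrite mxE.
by rewrite /cmx rmorphXn.
Qed.

(** * Difference operators on polyexponentials *)

(** The operator [V(E)] applied to [h] and evaluated at [k], where [E] is the shift sending [h(k)]
    to [h(k+1)]. *)
Definition shift_comb (R : nzRingType) (V : {poly R}) (h : nat -> R) (k : nat) : R :=
  \sum_(j < size V) V`_j * h (k + j)%N.

Lemma shift_combE (R : nzRingType) (V : {poly R}) (h : nat -> R) (k m : nat) :
  (size V <= m)%N -> shift_comb V h k = \sum_(j < m) V`_j * h (k + j)%N.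
Proof.
move=> Vm; rewrite /shift_comb (big_ord_widen _ (fun j => V`_j * h (k + j)%N) Vm).
rewrite big_mkcond; apply: eq_bigr => j _.
by case: ltnP => // /(nth_default 0) ->; rewrite mul0r.
Qed.

Lemma shift_combD (R : nzRingType) (V : {poly R}) (f g : nat -> R) (k : nat) :
  shift_comb V (fun j => f j + g j) k = shift_comb V f k + shift_comb V g k.
Proof. by rewrite -big_split; apply: eq_bigr => j _; rewrite mulrDr. Qed.

Lemma shift_combZ (R : comNzRingType) (V : {poly R}) (a : R) (f : nat -> R)
    (k : nat) :
  shift_comb V (fun j => a * f j) k = a * shift_comb V f k.
Proof. by rewrite big_distrr; apply: eq_bigr => j _ /=; rewrite mulrCA. Qed.

Lemma shift_comb_sum (R : comNzRingType) (V : {poly R}) (I : Type) (s : seq I)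
    (f : I -> nat -> R) (k : nat) :
  shift_comb V (fun j => \sum_(i <- s) f i j) k =
  \sum_(i <- s) shift_comb V (f i) k.
Proof.
by rewrite exchange_big; apply: eq_bigr => j _ /=; rewrite mulr_sumr.
Qed.

Lemma shift_comb1 (R : nzRingType) (h : nat -> R) (k : nat) :
  shift_comb 1 h k = h k.
Proof.
by rewrite /shift_comb size_polyC oner_eq0 big_ord1 coef1 mul1r addn0.
Qed.

Lemma shift_combXsubC (R : comNzRingType) (a : R) (V : {poly R}) (h : nat -> R)
    (k : nat) :
  shift_comb (('X - a%:P) * V) h k =
  shift_comb V (fun j => h j.+1 - a * h j) k.
Proof.
have sV : (size (('X - a%:P) * V)%R <= (size V).+1)%N.
  by rewrite (leq_trans (size_polyMleq _ _)) // size_XsubC.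
rewrite (shift_combE _ _ sV) (shift_combE _ _ (leqnSn _)).
under eq_bigr do rewrite mulrBl coefB coefXM coefCM mulrBl.
under [RHS]eq_bigr do rewrite mulrBr.
rewrite !big_split /= !sumrN; congr (_ - _); last first.
  by apply: eq_bigr => j _; rewrite mulrCA mulrA.
rewrite big_ord_recl /= mul0r add0r big_ord_recr /= nth_default // mul0r addr0.
by apply: eq_bigr => j _; rewrite addnS.
Qed.

(* [h |-> (k |-> h(k+1) - a h(k))] sends [p(k) l^k] to [(twisted_diff l a p)(k) l^k]. *)
Definition twisted_diff (R : comNzRingType) (l a : R) (p : {poly R}) : {poly R} :=
  l *: (p \Po ('X + 1)) - a *: p.

Definition twisted_diffs (R : comNzRingType) (l : R) (s : seq R) (p : {poly R}) :=
  foldl (fun q a => twisted_diff l a q) p s.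

Lemma twisted_diffE (R : comNzRingType) (l a : R) (p : {poly R}) (k : nat) :
  (twisted_diff l a p).[k%:R] * l ^+ k =
  p.[k.+1%:R] * l ^+ k.+1 - a * (p.[k%:R] * l ^+ k).
Proof.
rewrite /twisted_diff !hornerE horner_comp !hornerE /= natr1 exprS.
by ring.
Qed.

Lemma shift_comb_prod (R : comNzRingType) (l : R) (s : seq R) (p : {poly R})
    (k : nat) :
  shift_comb (\prod_(a <- s) ('X - a%:P)) (fun j => p.[j%:R] * l ^+ j) k =
  (twisted_diffs l s p).[k%:R] * l ^+ k.
Proof.
elim: s p => [|a s IH] p; first by rewrite big_nil shift_comb1.
rewrite big_cons shift_combXsubC /= -IH; apply: eq_bigr => j _.
by rewrite twisted_diffE.
Qed.

Lemma coef_comp_XD1 (R : comNzRingType) (p : {poly R}) (j : nat) :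
  (p \Po ('X + 1))`_j = \sum_(i < size p) p`_i * 'C(i, j)%:R.
Proof.
rewrite coef_comp_poly; apply: eq_bigr => i _; congr (_ * _).
rewrite exprD1n coef_sum; under eq_bigr do rewrite coefMn coefXn.
have [ij|ji] := ltnP i j.
  rewrite bin_small // big1 // => m _; rewrite gtn_eqF ?mul0rn //.
  by rewrite (leq_ltn_trans _ ij) // -ltnS.
rewrite (bigD1 (Ordinal (ji : (j < i.+1)%N))) //= eqxx big1 ?addr0 //.
by move=> m; rewrite -val_eqE /= eq_sym => /negPf ->; rewrite mul0rn.
Qed.

Lemma coef_comp_XD1_ge (R : comNzRingType) (p : {poly R}) (j : nat) :
  ((size p).-1 <= j)%N -> (p \Po ('X + 1))`_j = p`_j.
Proof.
move=> pj; rewrite coef_comp_XD1.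
have [jp|pj'] := ltnP j (size p); last first.
  rewrite nth_default // big1 // => i _; rewrite bin_small ?mulr0 //.
  exact: leq_trans pj'.
rewrite (bigD1 (Ordinal jp)) //= binn mulr1 big1 ?addr0 // => i.
rewrite -val_eqE neq_ltn => /orP[ij|] /=; first by rewrite bin_small ?mulr0.
rewrite ltnNge (leq_trans _ pj) // -ltnS (leq_trans (ltn_ord i)) //.
exact: leqSpred.
Qed.

(** Translation preserves the leading coefficient, so here it gets multiplied by [l - a]. *)
Lemma size_twisted_diff_neq (R : numFieldType) (l a : R) (p : {poly R}) :
  a != l -> size (twisted_diff l a p) = size p.
Proof.
move=> al; apply/eqP; rewrite eqn_leq; apply/andP; split.
  apply/leq_sizeP => j pj; rewrite coefB !coefZ coef_comp_XD1_ge; last first.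
    exact: leq_trans (leq_pred _) pj.
  by rewrite nth_default // !mulr0 subr0.
have [->|p0] := eqVneq p 0; first by rewrite size_poly0.
rewrite -(prednK (_ : 0 < size p)%N) ?size_poly_gt0 // ltnNge.
apply/negP => /leq_sizeP/(_ _ (leqnn _)); rewrite coefB !coefZ.
rewrite coef_comp_XD1_ge // -mulrBl => /eqP; rewrite mulf_eq0 subr_eq0 eq_sym.
by rewrite (negPf al) /= -lead_coefE lead_coef_eq0 (negPf p0).
Qed.

(** The leading terms cancel; in characteristic 0 the next coefficient of [p(X+1) - p] is the degree
    times the leading coefficient, which is nonzero for positive degree. *)
Lemma size_twisted_diff_eq (R : numFieldType) (l : R) (p : {poly R}) :
  l != 0 -> size (twisted_diff l l p) = (size p).-1.
Proof.
move=> l0; apply/eqP; rewrite eqn_leq; apply/andP; split.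
  apply/leq_sizeP => j pj; rewrite coefB !coefZ coef_comp_XD1_ge //.
  exact: subrr.
case sp : (size p) => [|[|d]] //=; rewrite ltnNge.
apply/negP => /leq_sizeP/(_ _ (leqnn _)); rewrite coefB !coefZ -mulrBr => /eqP.
rewrite mulf_eq0 (negPf l0) /= coef_comp_XD1 sp 2!big_ord_recr /= binn mulr1.
rewrite binSn big1 ?add0r; last by move=> i _; rewrite bin_small ?mulr0.
rewrite addrAC subrr add0r mulf_eq0 pnatr_eq0 orbF.
have := lead_coef_eq0 p; rewrite lead_coefE sp /= => ->.
by rewrite -size_poly_eq0 sp.
Qed.

Lemma size_twisted_diffs (R : numFieldType) (l : R) (s : seq R) (p : {poly R}) :
  l != 0 -> size (twisted_diffs l s p) = (size p - count_mem l s)%N.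
Proof.
move=> l0; elim: s p => [|a s IH] p /=; first by rewrite subn0.
rewrite IH; have [->|al] := eqVneq a l.
  by rewrite size_twisted_diff_eq // -subn1 subnDA.
by rewrite size_twisted_diff_neq.
Qed.

(** * Orders of magnitude n^(b + o(1)) *)

Lemma near_ln_ge (R : realType) (c : R) : \forall n \near \oo, c <= ln (n%:R : R).
Proof.
near=> n; rewrite -[leLHS]expRK ler_ln ?posrE ?expR_gt0 //.
  by near: n; exact: nbhs_infty_ger.
by rewrite ltr0n; near: n; exact: nbhs_infty_gt.
Unshelve. all: by end_near. Qed.

Lemma near_powR_ge (R : realType) (b c : R) :
  0 < b -> \forall n \near \oo, c <= (n%:R : R) `^ b.
Proof.
move=> b0; near=> n; have n0 : 0 < n%:R :> R.
  by rewrite ltr0n; near: n; exact: nbhs_infty_gt.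
have /ltW/(le_trans _) := ln_sublinear (powR_gt0 b n0); apply.
rewrite ln_powR mulrC -ler_pdivrMr //.
by near: n; exact: near_ln_ge.
Unshelve. all: by end_near. Qed.

(* [|f n| <= n ^ (b + o(1))] as [n] tends to infinity along [N]. *)
Definition pow_bounded (R : realType) (N : set nat) (b : R) (f : nat -> R) :=
  forall c : R, 0 < c ->
    \forall n \near \oo, N n -> `|f n| <= n%:R `^ (b + c).

Lemma pow_bounded_dom (R : realType) (N : set nat) (b : R) (f g : nat -> R) :
  (\forall n \near \oo, N n -> `|f n| <= `|g n|) ->
  pow_bounded N b g -> pow_bounded N b f.
Proof.
move=> fg bg c c0; have := bg c c0; apply: filterS2 fg => n fg gc Nn.
exact: le_trans (fg Nn) (gc Nn).
Qed.

Lemma pow_bounded_le (R : realType) (N : set nat) (a b : R) (f : nat -> R) :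
  a <= b -> pow_bounded N a f -> pow_bounded N b f.
Proof.
move=> ab bf c c0; near=> n => Nn.
have : `|f n| <= n%:R `^ (a + c) by move: Nn; near: n; exact: bf.
move=> /le_trans; apply; apply: ler_powR; last by rewrite lerD2r.
by rewrite ler1n; near: n; exact: nbhs_infty_gt.
Unshelve. all: by end_near. Qed.

Lemma pow_boundedD (R : realType) (N : set nat) (b : R) (f g : nat -> R) :
  pow_bounded N b f -> pow_bounded N b g ->
  pow_bounded N b (fun n => f n + g n).
Proof.
move=> bf bg c c0; have c2 : 0 < c / 2 by rewrite divr_gt0.
near=> n => Nn.
have fn : `|f n| <= n%:R `^ (b + c / 2) by move: Nn; near: n; exact: bf.
have gn : `|g n| <= n%:R `^ (b + c / 2) by move: Nn; near: n; exact: bg.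
apply: (le_trans (ler_normD _ _)); apply: (le_trans (lerD fn gn)).
(* One half of [n ^ c] absorbs the factor 2. *)
rewrite -mulr2n -[leLHS]mulr_natl [c in leRHS]splitr addrA [leRHS]powRD; last first.
  by apply/implyP => _; rewrite pnatr_eq0 -lt0n; near: n; exact: nbhs_infty_gt.
rewrite mulrC ler_wpM2l ?powR_ge0 //.
by near: n; exact: near_powR_ge.
Unshelve. all: by end_near. Qed.

Lemma pow_boundedM (R : realType) (N : set nat) (a b : R) (f g : nat -> R) :
  pow_bounded N a f -> pow_bounded N b g ->
  pow_bounded N (a + b) (fun n => f n * g n).
Proof.
move=> bf bg c c0; have c2 : 0 < c / 2 by rewrite divr_gt0.
near=> n => Nn.
have fn : `|f n| <= n%:R `^ (a + c / 2) by move: Nn; near: n; exact: bf.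
have gn : `|g n| <= n%:R `^ (b + c / 2) by move: Nn; near: n; exact: bg.
rewrite normrM (le_trans (ler_pM _ _ fn gn)) //.
rewrite -powRD; last first.
  by apply/implyP => _; rewrite pnatr_eq0 -lt0n; near: n; exact: nbhs_infty_gt.
by rewrite addrACA -splitr.
Unshelve. all: by end_near. Qed.

Lemma pow_bounded_cst (R : realType) (N : set nat) (a : R) :
  pow_bounded N 0 (fun=> a).
Proof. by move=> c c0; near=> n => _; rewrite add0r; near: n; exact: near_powR_ge.
Unshelve. all: by end_near. Qed.

Lemma pow_bounded_powR (R : realType) (N : set nat) (b : R) :
  pow_bounded N b (fun n => n%:R `^ b).
Proof.
move=> c c0; near=> n => _; rewrite ger0_norm ?powR_ge0 // ler_powR //.
  by rewrite ler1n; near: n; exact: nbhs_infty_gt.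
by rewrite lerDl ltW.
Unshelve. all: by end_near. Qed.

Lemma pow_boundedZ (R : realType) (N : set nat) (a b : R) (f : nat -> R) :
  pow_bounded N b f -> pow_bounded N b (fun n => a * f n).
Proof.
by move=> bf; rewrite -[b]add0r; apply: pow_boundedM => //; apply: pow_bounded_cst.
Qed.

Lemma pow_bounded0 (R : realType) (N : set nat) (b : R) :
  pow_bounded N b (fun=> 0).
Proof. by move=> c _; near=> n => _; rewrite normr0 powR_ge0.
Unshelve. all: by end_near. Qed.

Lemma pow_bounded_sum (R : realType) (N : set nat) (b : R) (I : eqType)
    (s : seq I) (f : I -> nat -> R) :
  (forall i, i \in s -> pow_bounded N b (f i)) ->
  pow_bounded N b (fun n => \sum_(i <- s) f i n).
Proof.
elim: s => [|i s IH] bf.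
  by apply: pow_bounded_dom (pow_bounded0 N b); near=> n => _; rewrite big_nil.
have bs : pow_bounded N b (fun n => \sum_(j <- s) f j n).
  by apply: IH => j js; apply: bf; rewrite in_cons js orbT.
have := pow_boundedD (bf i (mem_head _ _)) bs.
by apply: pow_bounded_dom; near=> n => _; rewrite big_cons.
Unshelve. all: by end_near. Qed.

Lemma pow_bounded_Xinv (R : realType) (N : set nat) (i : nat) :
  pow_bounded N (- i%:R) (fun n => (n%:R ^+ i)^-1 : R).
Proof.
apply: pow_bounded_dom (pow_bounded_powR N _); near=> n => _.
by rewrite powRN powR_mulrn.
Unshelve. all: by end_near. Qed.

Lemma pow_bounded_natr (R : realType) (N : set nat) :
  pow_bounded N (1 : R) (fun n => n%:R).
Proof.
apply: pow_bounded_dom (pow_bounded_powR N _); near=> n => _.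
by rewrite powRr1.
Unshelve. all: by end_near. Qed.

(** * Polynomials and powers at integers of logarithmic size *)

(** For large [k] the lower terms together are at most half of the leading term. *)
Lemma poly_nat_lower_bound (R : realType) (q : {poly R}) : q != 0 ->
  exists2 c : R, 0 < c & \forall k \near \oo, c <= `|q.[k%:R]|.
Proof.
move=> q0; have lq : 0 < `|lead_coef q| by rewrite normr_gt0 lead_coef_eq0.
exists (`|lead_coef q| / 2); first by rewrite divr_gt0.
move: lq; rewrite lead_coefE.
case sq : (size q) => [|d] /= lq; first by move: q0; rewrite -size_poly_eq0 sq.
near=> k; have k1 : 1 <= k%:R :> R.
  by rewrite ler1n; near: k; exact: nbhs_infty_gt.
have kS : (\sum_(i < d) `|q`_i|) / (`|q`_d| / 2) <= k%:R.
  by near: k; exact: nbhs_infty_ger.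
rewrite horner_coef sq big_ord_recr /=.
set r := \sum_(_ < _) _; have kd : 1 <= k%:R ^+ d :> R by rewrite exprn_ege1.
have kd0 : 0 <= k%:R ^+ d :> R by rewrite exprn_ge0.
have rle : `|r| <= `|q`_d| / 2 * k%:R ^+ d.
  have : `|r| <= (\sum_(i < d) `|q`_i|) * k%:R ^+ d.-1.
    rewrite mulr_suml (le_trans (ler_norm_sum _ _ _)) // ler_sum // => i _.
    rewrite normrM normrX normr_nat ler_wpM2l // ler_weXn2l //.
    by case: (d) i => [|?] [].
  move=> /le_trans; apply; case: (d) lq kd kS => [|e] lqd kd kS.
    by rewrite big_ord0 mul0r mulr_ge0 // divr_ge0.
  rewrite [in leRHS]exprS mulrA ler_wpM2r ?exprn_ge0 //.
  by rewrite [leRHS]mulrC -ler_pdivrMr // divr_gt0.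
rewrite addrC (le_trans _ (lerB_normD _ _)) // lerBrDl.
rewrite (le_trans (lerD rle (lexx _))) // normrM (ger0_norm kd0).
have : `|q`_d| / 2 <= `|q`_d| / 2 * k%:R ^+ d.
  by rewrite ler_peMr // divr_ge0.
lra.
Unshelve. all: by end_near. Qed.

(* An even integer [2 C ln n + O(1)]. *)
Definition even_log (R : realType) (C : R) (n : nat) : nat :=
  (2 * (Num.truncn (C * ln n%:R)).+1)%N.

Lemma odd_even_log (R : realType) (C : R) (n : nat) : odd (even_log C n) = false.
Proof. by rewrite /even_log mul2n odd_double. Qed.

Lemma even_log_ge (R : realType) (C : R) (n : nat) :
  2 * C * ln n%:R <= (even_log C n)%:R.
Proof.
rewrite natrM -mulrA ler_wpM2l //; exact/ltW/truncnS_gt.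
Qed.

Lemma even_log_le (R : realType) (C : R) (n : nat) : 0 <= C -> (0 < n)%N ->
  (even_log C n)%:R <= 2 * C * ln n%:R + 2.
Proof.
move=> C0 n0; rewrite natrM -[X in _ * X]natr1 mulrDr mulr1 lerD2r -mulrA ler_wpM2l //.
by rewrite truncn_le mulr_ge0 // ln_ge0 // ler1n.
Qed.

Lemma near_even_log_ge (R : realType) (C : R) (m : nat) : 0 < C ->
  \forall n \near \oo, (m <= even_log C n)%N.
Proof.
move=> C0; near=> n; rewrite -(ler_nat R) (le_trans _ (even_log_ge _ _)) //.
rewrite mulrC -ler_pdivrMr ?mulr_gt0 //.
by near: n; exact: near_ln_ge.
Unshelve. all: by end_near. Qed.

(** The hypothesis that [K n / ln n] tends to infinity enters here: the range in which the expansion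
    is valid eventually contains the chosen exponent together with any fixed number of shifts. *)
Lemma near_even_log_le (R : realType) (C : R) (d : nat) (K : nat -> nat) :
  0 < C -> ((K n)%:R / ln (n%:R : R)) @[n --> \oo] --> +oo ->
  \forall n \near \oo, (even_log C n + d <= K n)%N.
Proof.
move=> C0 /cvgryPge/(_ (2 * C + 2 + d%:R)) Koo; near=> n.
have n0 : (0 < n)%N by near: n; exact: nbhs_infty_gt.
have l1 : 1 <= ln n%:R :> R by near: n; exact: near_ln_ge.
have Kn : 2 * C + 2 + d%:R <= (K n)%:R / ln n%:R by near: n; exact: Koo.
rewrite -(ler_nat R) natrD.
move: Kn; rewrite ler_pdivlMr ?(lt_le_trans _ l1) // => /(le_trans _); apply.
rewrite (le_trans (lerD (even_log_le (ltW C0) n0) (lexx _))) //.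
have : d%:R <= d%:R * ln (n%:R : R) by rewrite ler_peMr.
by lra.
Unshelve. all: by end_near. Qed.

Lemma pow_bounded_even_log (R : realType) (N : set nat) (C : R) : 0 < C ->
  pow_bounded N 0 (fun n => (even_log C n)%:R : R).
Proof.
move=> C0 c c0; rewrite add0r; have c2 : 0 < c / 2 by rewrite divr_gt0.
near=> n => _.
have n0 : (0 < n)%N by near: n; exact: nbhs_infty_gt.
have nR : 0 < n%:R :> R by rewrite ltr0n.
have l1 : 1 <= ln n%:R :> R by near: n; exact: near_ln_ge.
rewrite normr_nat (le_trans (even_log_le (ltW C0) n0)) //.
have /ltW := ln_sublinear (powR_gt0 (c / 2) nR); rewrite ln_powR => lc.
have : (2 * C + 2) * ln n%:R <= (2 * C + 2) / (c / 2) * n%:R `^ (c / 2).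
  rewrite -[leRHS]mulrA ler_wpM2l ?addr_ge0 ?mulr_ge0 ?(ltW C0) //.
  by rewrite ler_pdivlMl.
have : (2 * C + 2) / (c / 2) * n%:R `^ (c / 2) <= n%:R `^ c.
  rewrite [c in leRHS]splitr [leRHS]powRD; last by rewrite (gt_eqF nR) implybT.
  by rewrite ler_wpM2r ?powR_ge0 //; near: n; exact: (near_powR_ge _ c2).
rewrite mulrDl; have : 2 <= 2 * ln (n%:R : R) by rewrite ler_peMr.
lra.
Unshelve. all: by end_near. Qed.

Lemma pow_bounded_poly_even_log (R : realType) (N : set nat) (C : R)
    (q : {poly R}) : 0 < C ->
  pow_bounded N 0 (fun n => q.[(even_log C n)%:R]).
Proof.
move=> C0; elim/poly_ind: q => [|q a IH].
  by apply: pow_bounded_dom (pow_bounded0 N 0); near=> n => _; rewrite horner0.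
apply: (@pow_bounded_dom _ _ _ _
  (fun n => q.[(even_log C n)%:R] * (even_log C n)%:R + a)).
  by near=> n => _; rewrite !hornerE.
apply: pow_boundedD (pow_bounded_cst _ _); rewrite -[0]addr0.
by apply: pow_boundedM => //; apply: pow_bounded_even_log.
Unshelve. all: by end_near. Qed.

(** [a ^ (2 C ln n) = n ^ (2 C ln a)], and rounding the exponent by at most 2 costs at most the
    constant factor [exp (2 |ln a|)]. *)
Lemma pow_bounded_expr_even_log (R : realType) (N : set nat) (C a : R) :
  0 < C -> 0 < a ->
  pow_bounded N (2 * C * ln a) (fun n => a ^+ even_log C n).
Proof.
move=> C0 a0.
apply: (@pow_bounded_dom _ _ _ _
  (fun n => expR (2 * `|ln a|) * n%:R `^ (2 * C * ln a))); last first.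
  exact/pow_boundedZ/pow_bounded_powR.
near=> n => _; have n0 : (0 < n)%N by near: n; exact: nbhs_infty_gt.
rewrite ger0_norm ?exprn_ge0 ?(ltW a0) //.
rewrite [leRHS]ger0_norm ?mulr_ge0 ?expR_ge0 ?powR_ge0 //.
rewrite -powR_mulrn ?(ltW a0) // /powR (gt_eqF a0) gt_eqF ?ltr0n //.
rewrite -expRD ler_expR.
rewrite (_ : 2 * C * ln a * _ = 2 * C * ln n%:R * ln a); last by ring.
rewrite -lerBlDr -mulrBl (le_trans (ler_norm _)) // normrM ler_wpM2r //.
have := even_log_ge C n; have := even_log_le (ltW C0) n0.
by rewrite ler_norml; lra.
Unshelve. all: by end_near. Qed.

(** A nonzero polynomial stays away from 0 at large integers, so it cannot decay like a negative
    power of [n] along the infinite set [N]. *)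
Lemma pow_bounded_poly_even_log_eq0 (R : realType) (N : set nat) (C b : R)
    (q : {poly R}) : infinite_set N -> 0 < C -> b < 0 ->
  pow_bounded N b (fun n => q.[(even_log C n)%:R]) -> q = 0.
Proof.
move=> Noo C0 b0 qb; apply/eqP/negPn/negP => /poly_nat_lower_bound[c c0].
move=> [m _ cq].
have b2 : 0 < - b / 2 by rewrite divr_gt0 // oppr_gt0.
(* With [P = n ^ (- b / 2)], the two bounds [c * P <= 1] and [2 <= c * P] contradict each other. *)
have cb := near_powR_ge (2 / c) b2.
have [M _ HM] := filterI (filterI (qb _ b2) cb) (near_even_log_ge m C0).
have [n Nn Mn] : exists2 n, N n & (M <= n)%N.
  apply: contrapT => nMn; apply: Noo; apply: (@sub_finite_set _ _ `I_M).
    by move=> n Nn /=; rewrite ltnNge; apply/negP => Mn; apply: nMn; exists n.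
  exact: finite_II.
have [[/= /(_ Nn) qn cn] mn] := HM n Mn.
have := cq _ mn; move/le_trans/(_ qn).
rewrite (_ : b + - b / 2 = - (- b / 2)); last by field.
rewrite powRN => cle.
have P0 : 0 < n%:R `^ (- b / 2) :> R.
  by rewrite (lt_le_trans _ cn) // divr_gt0.
move: cle; rewrite -div1r ler_pdivlMr // mulrC => cle.
by move: cn; rewrite ler_pdivrMr // => /le_trans/(_ cle); rewrite lern1.
Qed.

Local Open Scope complex_scope.

(** * Growth and larger bases *)

Lemma bernoulli_expr (R : realDomainType) (z : R) (k : nat) :
  1 <= z -> 1 + (z - 1) *+ k <= z ^+ k.
Proof.
move=> z1; elim: k => [|k IH]; first by rewrite mulr0n addr0.
have zk : 1 <= z ^+ k by rewrite exprn_ege1.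
rewrite mulrS exprS; have : 0 <= (z - 1) * (z ^+ k - 1).
  by rewrite mulr_ge0 ?subr_ge0.
lra.
Qed.

(** Let [s] be the square root of [z]. By Bernoulli's inequality [k (s - 1) <= s ^ k], and
    eventually also [c / (s - 1) <= s ^ k]; multiplying the two gives the bound. *)
Lemma near_expr_ge_natr (R : realType) (z c : R) :
  1 < z -> \forall k \near \oo, c * k%:R <= z ^+ k.
Proof.
move=> z1; have s1 : 1 < Num.sqrt z by rewrite -sqrtr1 ltr_sqrt // (lt_trans _ z1).
have z0 : 0 <= z by rewrite ltW // (lt_trans _ z1).
have d0 : 0 < Num.sqrt z - 1 by rewrite subr_gt0.
near=> k.
have sk := bernoulli_expr k (ltW s1).
have cs : c / (Num.sqrt z - 1) <= Num.sqrt z ^+ k.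
  apply: le_trans sk; rewrite (@le_trans _ _ ((Num.sqrt z - 1) *+ k)) //; last first.
    by rewrite lerDr.
  rewrite -mulr_natl -ler_pdivrMr //.
  by near: k; exact: nbhs_infty_ger.
have ks : k%:R * (Num.sqrt z - 1) <= Num.sqrt z ^+ k.
  by apply: le_trans sk; rewrite mulr_natl lerDr.
rewrite -[in leRHS](sqr_sqrtr z0) exprAC expr2.
move: cs; rewrite ler_pdivrMr // => cs.
have [c0|c0] := ltP 0 c; last first.
  by rewrite (@le_trans _ _ 0) // ?mulr_le0_ge0 // -expr2 sqr_ge0.
rewrite -(ler_pM2r d0) -mulrA (le_trans (ler_wpM2l (ltW c0) ks)) //.
by rewrite [leRHS]mulrAC ler_wpM2r // exprn_ge0 // sqrtr_ge0.
Unshelve. all: by end_near. Qed.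

Lemma near_expr_ge (R : realType) (z c : R) :
  1 < z -> \forall k \near \oo, c <= z ^+ k.
Proof.
move=> z1; near=> k; rewrite (@le_trans _ _ (`|c| * k%:R)) //.
  rewrite (le_trans (ler_norm _)) // ler_peMr // ler1n.
  by near: k; exact: nbhs_infty_gt.
by near: k; exact: near_expr_ge_natr.
Unshelve. all: by end_near. Qed.

Lemma ReK_norm (R : realType) (z : R[i]) : (complex.Re `|z|)%:C = `|z|.
Proof. by rewrite normc_def. Qed.

(** A subexponential factor is absorbed by the ratio of [rho + e] to [rho + e / 2], which exceeds
    1. *)
Lemma growthM (R : realType) (rho : R) (u f : nat -> R[i]) : 0 < rho ->
  (forall z : R, 1 < z -> \forall k \near \oo, `|u k| <= (z ^+ k)%:C) ->
  growth rho f -> growth rho (fun k => u k * f k).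
Proof.
move=> r0 ug fg e e0; set a := rho + e / 2.
have e2 : 0 < e / 2 by rewrite divr_gt0.
have a0 : 0 < a by rewrite addr_gt0.
have z1 : 1 < (rho + e) / a by rewrite ltr_pdivlMr // mul1r ltrD2l ltr_pdivrMr //; lra.
apply: filterS2 (ug _ z1) (fg _ e2) => k uk fk.
have zk : 0 < ((rho + e) / a) ^+ k by rewrite exprn_gt0 // (lt_trans _ z1).
rewrite normrM (_ : (rho + e) ^+ k = ((rho + e) / a) ^+ k * a ^+ k); last first.
  by rewrite -exprMn divfK // gt_eqF.
rewrite rmorphM /= (le_lt_trans (ler_wpM2r (normr_ge0 _) uk)) //.
by rewrite ltr_pM2l // ltcR.
Qed.

Lemma growthZ (R : realType) (rho : R) (c : R[i]) (f : nat -> R[i]) : 0 < rho ->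
  growth rho f -> growth rho (fun k => c * f k).
Proof.
move=> r0; apply: growthM => // z z1.
apply: filterS (near_expr_ge (complex.Re `|c|) z1) => k ck.
by rewrite -[leLHS]ReK_norm lecR.
Qed.

Lemma growth_natr (R : realType) (rho : R) (f : nat -> R[i]) : 0 < rho ->
  growth rho f -> growth rho (fun k => k%:R * f k).
Proof.
move=> r0; apply: growthM => // z z1.
apply: filterS (near_expr_ge_natr 1 z1) => k ck.
by rewrite normr_nat -(rmorph_nat (real_complex R)) lecR -[leLHS]mul1r.
Qed.

(** The growth of [2 f] and [2 g] bounds each summand by half of [(rho + e) ^ k], so [e] need not be
    split. *)
Lemma growthD (R : realType) (rho : R) (f g : nat -> R[i]) : 0 < rho ->
  growth rho f -> growth rho g -> growth rho (fun k => f k + g k).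
Proof.
move=> r0 /(growthZ 2 r0) fg /(growthZ 2 r0) gg e e0.
apply: filterS2 (fg _ e0) (gg _ e0) => k; rewrite !normrM !normr_nat => fk gk.
rewrite (le_lt_trans (ler_normD _ _)) //.
rewrite -(ltr_pM2l (_ : 0 < 2 :> R[i])) // mulrDr [ltRHS]mulr_natl mulr2n.
by rewrite ltrD.
Qed.

Lemma growth0 (R : realType) (rho : R) : 0 < rho -> growth rho (fun=> 0 : R[i]).
Proof.
by move=> r0 e e0; near=> k; rewrite normr0 ltcR exprn_gt0 // addr_gt0.
Unshelve. all: by end_near. Qed.

Lemma growth_near_eq (R : realType) (rho : R) (f g : nat -> R[i]) :
  (\forall k \near \oo, f k = g k) -> growth rho f -> growth rho g.
Proof.
move=> fg fr e e0; apply: filterS2 fg (fr _ e0) => k <-. exact.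
Qed.

Lemma growth_sum (R : realType) (rho : R) (I : eqType) (s : seq I)
    (f : I -> nat -> R[i]) : 0 < rho ->
  (forall i, i \in s -> growth rho (f i)) ->
  growth rho (fun k => \sum_(i <- s) f i k).
Proof.
move=> r0; elim: s => [|i s IH] fg.
  by apply: growth_near_eq (growth0 r0); near=> k; rewrite big_nil.
apply: (@growth_near_eq _ _ (fun k => f i k + \sum_(j <- s) f j k)).
  by near=> k; rewrite big_cons.
apply: growthD => //; first by apply: fg; rewrite mem_head.
by apply: IH => j js; apply: fg; rewrite in_cons js orbT.
Unshelve. all: by end_near. Qed.

Lemma growth_expr (R : realType) (rho : R) (l : R[i]) : 0 < rho ->
  `|l| <= rho%:C -> growth rho (fun k => l ^+ k).
Proof.
move=> r0 lr e e0; near=> k; rewrite normrX.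
have k0 : (0 < k)%N by near: k; exact: nbhs_infty_gt.
rewrite (_ : (_ ^+ k)%:C = ((rho + e)%:C) ^+ k) ?rmorphXn // ltrXn2r -?lt0n //.
by rewrite (le_lt_trans lr) // ltcR ltrDl.
Unshelve. all: by end_near. Qed.

Lemma growth_poly_expr (R : realType) (rho : R) (p : {poly R[i]}) (l : R[i]) :
  0 < rho -> `|l| <= rho%:C -> growth rho (fun k => p.[k%:R] * l ^+ k).
Proof.
move=> r0 lr; elim/poly_ind: p => [|p a IH].
  by apply: growth_near_eq (growth0 r0); near=> k; rewrite horner0 mul0r.
apply: (@growth_near_eq _ _
  (fun k => k%:R * (p.[k%:R] * l ^+ k) + a * l ^+ k)).
  by near=> k; rewrite hornerMXaddC mulrDl mulrA [k%:R * _]mulrC.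
apply: growthD => //; first exact: growth_natr.
exact/growthZ/growth_expr.
Unshelve. all: by end_near. Qed.

Lemma growth_polyexp_term (R : realType) (rho : R) (l : R[i]) (t : nat -> R[i]) :
  0 < rho -> `|l| <= rho%:C -> polyexp_term l t -> growth rho t.
Proof.
move=> r0 lr; rewrite /polyexp_term; case: eqP => [_ t0|_ [p tp]].
  by apply: growth_near_eq (growth0 r0); apply: filterS t0 => k ->.
apply: growth_near_eq (growth_poly_expr p r0 lr).
by near=> k; rewrite tp //; near: k; exact: nbhs_infty_gt.
Unshelve. all: by end_near. Qed.

Lemma polyexp_bases (R : realType) (Q : nat -> R[i]) :
  polyexp Q -> exists L, is_bases Q L.
Proof.
case=> L; have [m] := ubnP #|` L|%fset; elim: m L => // m IH L Lm QL.
have [[L' [LL' QL']]|nL'] := pselect (exists L', (L' `<` L)%fset /\ polyexp_over L' Q).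
  by apply: (IH L') => //; rewrite (leq_trans (fproper_ltn_card LL')).
by exists L; split=> // L' LL' QL'; apply: nL'; exists L'.
Qed.

(** Terms whose base has modulus at most [rho] have growth [rho] and move into the error. If a
    proper subset sufficed for the remaining terms, joining it with the discarded bases would
    contradict the minimality of [L]. *)
Lemma approx_polyexp_larger_bases (R : realType) (rho : R) (Q : nat -> R[i]) :
  0 < rho -> approx_polyexp rho Q -> exists L, is_larger_bases rho Q L.
Proof.
move=> r0 [f [g [Qfg /polyexp_bases[L [[t [tL ft]] Lmin]] gg]]].
pose Lb := [fset l in L | rho%:C < `|l|]%fset.
pose Ls := [fset l in L | ~~ (rho%:C < `|l|)]%fset.
have fE k : \sum_(l <- L) t l k = \sum_(l <- Lb) t l k + \sum_(l <- Ls) t l k.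
  rewrite (bigID (fun l => rho%:C < `|l|)) /=.
  by congr (_ + _); rewrite -big_filter; apply: perm_big;
     apply: uniq_perm; rewrite ?filter_uniq ?fset_uniq // => l;
     rewrite mem_filter !inE andbC.
exists Lb, (fun k => \sum_(l <- Lb) t l k), (fun k => g k + \sum_(l <- Ls) t l k).
split.
- by move=> k k0; rewrite Qfg // ft // fE [g k + _]addrC addrA.
- split; first by exists t; split=> // l; rewrite !inE => /andP[lL _]; apply: tL.
  move=> L' LL' [t' [tL' ft']].
  have dL' l : l \in L' -> l \notin Ls.
    move=> lL'; have /fsubsetP/(_ _ lL') := fproper_sub LL'.
    by rewrite !inE => /andP[_ ->]; rewrite andbF.
  have sL' l : l \in L' -> l \in Lb by apply/fsubsetP/fproper_sub.
  apply: (Lmin (L' `|` Ls)%fset).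
    rewrite fproperE; apply/andP; split.
      by apply/fsubsetP => l; rewrite !inE => /orP[/sL'|/andP[]//]; rewrite !inE => /andP[].
    apply/negP => /fsubsetP LL; move: LL'; rewrite fproperE => /andP[_ /negP]; apply.
    apply/fsubsetP => l; rewrite !inE => /andP[lL lb].
    by have := LL _ lL; rewrite !inE lb andbF orbF.
  exists (fun l => if l \in L' then t' l else t l); split.
    move=> l; rewrite inE; case: ifP => [lL' _|_ /=]; first exact: tL'.
    by rewrite !inE => /andP[lL _]; apply: tL.
  move=> k k0; rewrite ft // fE ft' //.
  have pL : perm_eq (L' `|` Ls)%fset (L' ++ Ls).
    apply: uniq_perm; rewrite ?fset_uniq //; last by move=> l; rewrite inE mem_cat.
    rewrite cat_uniq !fset_uniq /= andbT; apply/hasPn => l lLs.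
    by apply/negP => /dL'; rewrite lLs.
  rewrite (perm_big _ pL) big_cat /=; congr (_ + _); apply: eq_big_seq => l lL; first by rewrite lL.
  by case: ifP => // /dL'; rewrite lL.
- by move=> l; rewrite !inE => /andP[].
- apply: growthD => //; apply: growth_sum => // l; rewrite !inE => /andP[lL lr].
  apply: growth_polyexp_term (tL _ lL) => //.
  by rewrite -ReK_norm lecR leNgt -ltcR ReK_norm.
Qed.

(** A base of modulus above [rho > 0] is nonzero, so its term is a genuine polynomial times a
    power. *)
Lemma larger_bases_decomposition (R : realType) (rho : R) (Q : nat -> R[i])
    (L : {fset R[i]}) : 0 < rho -> is_larger_bases rho Q L ->
  exists (p : R[i] -> {poly R[i]}) (g : nat -> R[i]),
    [/\ forall k, (0 < k)%N -> Q k = \sum_(l <- L) (p l).[k%:R] * l ^+ k + g k,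
        forall l, l \in L -> rho%:C < `|l|
      & growth rho g].
Proof.
move=> r0 [f [g [Qfg [[t [tL ft]] _] Lr gg]]].
have /choice[p pt] : forall l, exists p : {poly R[i]}, l \in L ->
    forall k, (0 < k)%N -> t l k = p.[k%:R] * l ^+ k.
  move=> l; have [lL|] := boolP (l \in L); last by exists 0.
  have := tL _ lL; rewrite /polyexp_term; case: eqP => [l0|_ [p pt]]; last by exists p.
  by have := Lr _ lL; rewrite l0 normr0 ltcR ltNge ltW.
exists p, g; split=> // k k0; rewrite Qfg // ft //; congr (_ + _).
by apply: eq_big_seq => l lL; apply: pt.
Qed.

(** * Passage to an expansion with real coefficients *)

Lemma ReB (R : rcfType) (y z : R[i]) :
  complex.Re (y - z) = complex.Re y - complex.Re z.
Proof. by case: y z => [? ?] []. Qed.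

Lemma ReD (R : rcfType) (y z : R[i]) :
  complex.Re (y + z) = complex.Re y + complex.Re z.
Proof. by case: y z => [? ?] []. Qed.

Lemma ReM_real (R : rcfType) (z : R[i]) (a : R) :
  complex.Re (z * a%:C) = complex.Re z * a.
Proof. by case: z => x y; simpc. Qed.

Lemma Re_sum (R : rcfType) (I : Type) (s : seq I) (F : I -> R[i]) :
  complex.Re (\sum_(i <- s) F i) = \sum_(i <- s) complex.Re (F i).
Proof. by apply: (big_morph _ _ (erefl _)) => - [? ?] []. Qed.

Lemma Re_poly_nat (R : rcfType) (p : {poly R[i]}) (k : nat) :
  complex.Re p.[k%:R] = (\poly_(j < size p) complex.Re p`_j).[k%:R].
Proof.
rewrite horner_poly horner_coef Re_sum; apply: eq_bigr => j _ /=.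
rewrite -natrX -(rmorph_nat (real_complex R)) natrX.
exact: ReM_real.
Qed.

(* [tau n] has an expansion in powers of [1 / n] up to order [r]; the [i]-th
   coefficient is [sum_l p_(i,l)(k) l^k] up to the error [g i] of growth [rho]. *)
Definition real_expansion (R : realType) (rho Lambda1 : R) (N : set nat)
    (tau : nat -> nat -> R) (r : nat) (L : seq R) (p : nat -> R -> {poly R}) :=
  exists (g : nat -> nat -> R) (h : nat -> R) (K : nat -> nat),
    [/\ forall i a, (i < r)%N -> rho < a ->
          \forall k \near \oo, `|g i k| <= a ^+ k,
        forall a, Lambda1 < a -> \forall k \near \oo, `|h k| <= a ^+ k,
        ((K n)%:R / ln (n%:R : R)) @[n --> \oo] --> +oo
      & forall n k, N n -> (1 <= k <= K n)%N ->
          `|tau n k - \sum_(i < r)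
             (\sum_(l <- L) (p i l).[k%:R] * l ^+ k + g i k) / n%:R ^+ i|
          <= h k / n%:R ^+ r].

Lemma growth_Re (R : realType) (rho a : R) (f : nat -> R[i]) :
  rho < a -> growth rho f ->
  \forall k \near \oo, complex.Re `|f k| <= a ^+ k.
Proof.
move=> ra /(_ (a - rho)); rewrite subr_gt0 => /(_ ra).
apply: filterS => k; rewrite addrCA subrr addr0 -ReK_norm ltcR; exact: ltW.
Qed.

Lemma norm_Re_le (R : realType) (z : R[i]) : `|complex.Re z| <= complex.Re `|z|.
Proof. by rewrite -lecR ReK_norm; exact: normc_ge_Re. Qed.

(** The traces, the larger bases and the powers of [n] are real, so taking real parts keeps the
    shape of the expansion and only replaces the coefficients of the polynomials by their real
    parts. One list [L] serves all orders: [p i l] is 0 when [l] is not a base of [c i]. *)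
Lemma order_expansion_real (R : realType) (Lambda0 Lambda1 : R) (N : set nat)
    (M : forall n, matrix_space R n) (r : nat) (c : nat -> nat -> R[i]) :
  0 < Lambda0 -> 0 < Lambda1 -> order_expansion Lambda0 Lambda1 N M r c ->
  exists (L : seq R) (p : nat -> R -> {poly R}),
    [/\ uniq L,
        forall l, l \in L ->
          Lambda0 < `|l| <= Lambda1 /\ expansion_bases Lambda0 r c l%:C
      & real_expansion Lambda0 Lambda1 N
          (fun n k => expect (M n) (fun A => \tr (A ^+ k))) r L p].
Proof.
move=> L0 L1 [[K [K0 Koo [B trB]]] cr ci].
have /choice[X HX] i : exists X : {fset R[i]} * (R[i] -> {poly R[i]}) * (nat -> R[i]),
    (i < r)%N ->
    [/\ forall k, (0 < k)%N ->
          c i k = \sum_(l <- X.1.1) (X.1.2 l).[k%:R] * l ^+ k + X.2 k,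
        forall l, l \in X.1.1 -> [/\ Lambda0%:C < `|l|, larger_bases Lambda0 (c i) l
          & real_segment (- Lambda1) Lambda1 l]
      & growth Lambda0 X.2].
  (* Dummy data for the orders [i >= r]. *)
  have [ir|] := ltnP i r; last by exists (fset0, fun=> 0, fun=> 0).
  have [cia cis] := ci i ir.
  have [Li LiP] := approx_polyexp_larger_bases L0 cia.
  have [p [g [cE Lr gg]]] := larger_bases_decomposition L0 LiP.
  exists (Li, p, g) => _; split=> //= l lL.
  have lb : larger_bases Lambda0 (c i) l by exists Li.
  by split=> //; [exact: Lr|exact: cis].
pose L := undup (flatten [seq [seq complex.Re l | l <- (X i).1.1] | i <- iota 0 r]).
pose p i (x : R) : {poly R} := if x%:C \in (X i).1.1 then
  \poly_(j < size ((X i).1.2 x%:C)) complex.Re ((X i).1.2 x%:C)`_j else 0.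
have LP x : x \in L <-> exists2 i, (i < r)%N & x%:C \in (X i).1.1.
  rewrite mem_undup; split.
    move=> /flattenP[s /mapP[j]]; rewrite mem_iota add0n => /andP[_ jr] ->.
    move=> /mapP[l lX ->].
    have [_ /(_ _ lX)[_ _ [y _ ly]] _] := HX j jr.
    by exists j => //; rewrite -ly /= ly.
  move=> [i ir xX]; apply/flattenP.
  exists [seq complex.Re l | l <- (X i).1.1]; first by apply: map_f; rewrite mem_iota.
  by apply/mapP; exists x%:C.
exists L, p; split; first exact: undup_uniq.
  move=> x /LP[i ir xX]; have [_ /(_ _ xX)[xr xb [y /= yL [yx]]] _] := HX i ir.
  split; last by exists i.
  rewrite -yx in xr *; move: xr; rewrite normc_def /= expr0n addr0 sqrtr_sqr ltcR => ->.
  by rewrite ler_norml.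
exists (fun i k => complex.Re ((X i).2 k)), (fun k => complex.Re (`|B%:C * c r k|)), K.
split=> //.
- move=> i a ir ra; have [_ _ /(growth_Re ra)] := HX i ir.
  by apply: filterS => k; apply: le_trans; apply: norm_Re_le.
- move=> a ra; have := growth_Re ra (growthZ B%:C L1 cr).
  apply: filterS => k; apply: le_trans.
  by rewrite -[X in _ <= complex.Re X]normr_id norm_Re_le.
move=> n k Nn kK; have k0 : (0 < k)%N by case/andP: kK.
have := trB n Nn k kK.
(* The sign of [B] is unknown, so it is put inside the norm. *)
have BB : B%:C * `|c r k| <= `|B%:C * c r k|.
  by rewrite normrM ler_wpM2r // normc_def /= expr0n addr0 sqrtr_sqr lecR ler_norm.
have n0 : 0 <= (n%:R ^+ r)^-1 :> R[i] by rewrite invr_ge0 exprn_ge0.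
move=> /le_trans/(_ (ler_wpM2r n0 BB)).
rewrite -[leLHS]ReK_norm -[X in _ <= X * _]ReK_norm.
rewrite -(rmorph_nat (real_complex R)) -rmorphXn -fmorphV -rmorphM /= lecR.
apply: le_trans; apply: le_trans (norm_Re_le _); rewrite ReB.
rewrite le_eqVlt; apply/orP; left; apply/eqP; congr (`|_ - _|).
rewrite Re_sum; apply: eq_bigr => i _; have [cE cL _] := HX i (ltn_ord i).
rewrite -(rmorphXn (real_complex R)) -(fmorphV (real_complex R)) ReM_real; congr (_ / _); rewrite cE // ReD Re_sum.
congr (_ + _).
(* The larger bases of [c i] are exactly the elements of [L] at which [p i] is not set to 0 by
   default. *)
have pL : perm_eq [seq x%:C | x <- L & x%:C \in (X i).1.1] (X i).1.1.
  apply: uniq_perm; rewrite ?fset_uniq //.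
    by rewrite map_inj_uniq ?filter_uniq ?undup_uniq //; exact: complexI.
  move=> l; apply/mapP/idP => [[x]|lX]; first by rewrite mem_filter => /andP[xX _] ->.
  have [_ _ [y _ yl]] := cL _ lX; exists y => //.
  by rewrite mem_filter yl lX; apply/LP; exists i => //; rewrite yl.
rewrite -(perm_big _ pL) big_map big_filter [RHS]big_mkcond.
apply: eq_bigr => x _; rewrite /p; case: ifP => _; last by rewrite horner0 mul0r.
by rewrite -rmorphXn ReM_real Re_poly_nat.
Qed.

(** * Counting eigenvalues with a nonnegative polynomial *)

(** Both sides are the trace of [A^k V(A)]. The sum over the eigenvalues is real, so real parts may
    be taken term by term. *)
Lemma shift_comb_mxtrace (R : realType) (n : nat) (A : 'M[R]_n) (V : {poly R})
    (k : nat) :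
  shift_comb V (fun j => \tr (A ^+ j)) k =
  \sum_(z <- eigenvalues A) complex.Re (z ^+ k * (map_poly (real_complex R) V).[z]).
Proof.
suff E : (shift_comb V (fun j => \tr (A ^+ j)) k)%:C =
    \sum_(z <- eigenvalues A) z ^+ k * (map_poly (real_complex R) V).[z].
  by rewrite -Re_sum -E.
rewrite /shift_comb rmorph_sum /=.
under eq_bigr do rewrite rmorphM /= mxtrace_exp_eigenvalues mulr_sumr.
rewrite exchange_big; apply: eq_bigr => z _ /=.
rewrite horner_coef size_map_poly mulr_sumr; apply: eq_bigr => j _.
by rewrite coef_map exprD mulrCA.
Qed.

Lemma poly_ball_bound (R : realType) (rho : R) (V : {poly R}) : 0 <= rho ->
  exists2 C : R, 0 <= C & forall z : R[i], `|z| <= rho%:C ->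
    `|(map_poly (real_complex R) V).[z]| <= C%:C.
Proof.
move=> r0; exists (\sum_(j < size V) `|V`_j| * rho ^+ j).
  by rewrite sumr_ge0 // => j _; rewrite mulr_ge0 // exprn_ge0.
move=> z zr; rewrite horner_coef size_map_poly rmorph_sum /=.
rewrite (le_trans (ler_norm_sum _ _ _)) // ler_sum // => j _.
rewrite coef_map /= normrM normrX rmorphM rmorphXn /=.
rewrite normc_def /= expr0n addr0 sqrtr_sqr ler_wpM2l ?ler0c //.
by rewrite lerXn2r // nnegrE ?ler0c.
Qed.

(** Each eigenvalue in the ball lies in [S] and contributes at least [- rho^k C], which the last
    term compensates. A real eigenvalue contributes a nonnegative amount because [k] is even and
    [V >= 0], and at least [v] when it lies outside [S]. *)
Lemma eigenvalue_count_le (R : realType) (n : nat) (A : 'M[R]_n)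
    (rho Lambda v C : R) (V : {poly R}) (k : nat) (S : set R[i]) :
  (forall z, eigenvalue (cmx A) z ->
     (cball rho 0 `|` real_segment (- Lambda) Lambda) z) ->
  0 <= rho -> cball rho 0 `<=` S -> ~~ odd k -> 0 <= C ->
  (forall z : R[i], `|z| <= rho%:C ->
     `|(map_poly (real_complex R) V).[z]| <= C%:C) ->
  (forall x : R, 0 <= V.[x]) ->
  (forall x : R, - Lambda <= x <= Lambda -> ~ S x%:C -> v <= x ^+ k * V.[x]) ->
  (count [pred z | z \notin S] (eigenvalues A))%:R * v <=
  shift_comb V (fun j => \tr (A ^+ j)) k + n%:R * (rho ^+ k * C).
Proof.
move=> spec r0 rS ek C0 VC V0 Vv.
rewrite shift_comb_mxtrace -[X in X%:R * (_ * C)](size_eigenvalues A) -sum1_count -sum1_size.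
rewrite !natr_sum !mulr_suml -big_split big_mkcond !big_seq; apply: ler_sum => z.
rewrite mem_eigenvalues mul1r => /spec Sz.
have rC : 0 <= rho ^+ k * C by rewrite mulr_ge0 // exprn_ge0.
case: Sz => [zr|[x /= xL <-]].
  rewrite inE/= ifF; last by apply/negbTE/negPn; rewrite inE; exact: rS.
  rewrite mul1r; set w := z ^+ k * _.
  suff wC : complex.Re `|w| <= rho ^+ k * C.
    by have := norm_Re_le w; rewrite ler_norml; lra.
  rewrite -lecR ReK_norm normrM normrX rmorphM rmorphXn /=.
  move: zr; rewrite /cball/= subr0 => zr.
  by rewrite ler_pM ?exprn_ge0 ?VC // lerXn2r // nnegrE ler0c.
have -> : complex.Re (x%:C ^+ k * (map_poly (real_complex R) V).[x%:C]) =
    x ^+ k * V.[x].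
  by rewrite horner_map -(rmorphXn (real_complex R)) -(rmorphM (real_complex R)).
have xV : 0 <= x ^+ k * V.[x] by rewrite mulr_ge0 // exprn_even_ge0.
case: ifPn => [|_]; last by rewrite mul1r addr_ge0.
rewrite /= notin_setE => /(Vv _ xL) vx; rewrite mul1r ler_wpDr //.
Qed.

Lemma expect_le (R : realType) (n : nat) (M : matrix_space R n)
    (f g : 'M[R]_n -> R) :
  (forall A, A \in atoms M -> f A <= g A) -> expect M f <= expect M g.
Proof.
move=> fg; rewrite /expect !big_seq; apply: ler_sum => A AM.
by rewrite ler_wpM2l ?fg // ltW // prob_gt0.
Qed.

Lemma expect_shift_comb (R : realType) (n : nat) (M : matrix_space R n)
    (V : {poly R}) (k : nat) (c : R) :
  expect M (fun A => shift_comb V (fun j => \tr (A ^+ j)) k + c) =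
  shift_comb V (fun j => expect M (fun A => \tr (A ^+ j))) k + c.
Proof.
rewrite /expect shift_comb_sum.
under eq_bigr do rewrite mulrDr.
rewrite big_split /= -mulr_suml prob_sum1 mul1r; congr (_ + _).
by apply: eq_bigr => A _; rewrite shift_combZ.
Qed.

Lemma Eout_le (R : realType) (n : nat) (M : matrix_space R n)
    (rho Lambda v C : R) (V : {poly R}) (k : nat) (S : set R[i]) :
  (forall A, A \in atoms M -> forall z, eigenvalue (cmx A) z ->
     (cball rho 0 `|` real_segment (- Lambda) Lambda) z) ->
  0 <= rho -> cball rho 0 `<=` S -> ~~ odd k -> 0 <= C ->
  (forall z : R[i], `|z| <= rho%:C ->
     `|(map_poly (real_complex R) V).[z]| <= C%:C) ->
  (forall x : R, 0 <= V.[x]) ->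
  (forall x : R, - Lambda <= x <= Lambda -> ~ S x%:C -> v <= x ^+ k * V.[x]) ->
  Eout M S * v <=
  shift_comb V (fun j => expect M (fun A => \tr (A ^+ j))) k +
    n%:R * (rho ^+ k * C).
Proof.
move=> spec r0 rS ek C0 VC V0 Vv.
rewrite -expect_shift_comb /Eout {1}/expect mulr_suml.
under eq_bigr do rewrite -mulrA.
apply: expect_le => A AM; apply: eigenvalue_count_le Vv => //; exact: spec.
Qed.

(** The case [v = 0], [S = setT] of [Eout_le]: positivity of [V] passes to the mean traces up to the
    contribution of the ball. *)
Lemma shift_comb_expect_ge (R : realType) (n : nat) (M : matrix_space R n)
    (rho Lambda C : R) (V : {poly R}) (k : nat) :
  (forall A, A \in atoms M -> forall z, eigenvalue (cmx A) z ->
     (cball rho 0 `|` real_segment (- Lambda) Lambda) z) ->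
  0 <= rho -> ~~ odd k -> 0 <= C ->
  (forall z : R[i], `|z| <= rho%:C ->
     `|(map_poly (real_complex R) V).[z]| <= C%:C) ->
  (forall x : R, 0 <= V.[x]) ->
  0 <= shift_comb V (fun j => expect M (fun A => \tr (A ^+ j))) k +
         n%:R * (rho ^+ k * C).
Proof.
move=> spec r0 ek C0 VC V0.
have := @Eout_le _ _ M rho Lambda 0 C V k setT spec r0 (@subsetT _ _) ek C0 VC V0.
by rewrite mulr0; apply => x _ [].
Qed.

(** * The expansion at a logarithmic exponent *)

Lemma near_forall_ltn (r : nat) (P : nat -> nat -> Prop) :
  (forall i, (i < r)%N -> \forall k \near \oo, P i k) ->
  \forall k \near \oo, forall i, (i < r)%N -> P i k.
Proof.
elim: r => [|r IH] HP; first by near=> k.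
have Hr : \forall k \near \oo, forall i, (i < r)%N -> P i k.
  by apply: IH => i ir; apply: HP; rewrite ltnS ltnW.
apply: filterS2 Hr (HP _ (ltnSn r)) => k kr kP i.
by rewrite ltnS leq_eqVlt => /orP[/eqP->//|]; apply: kr.
Unshelve. all: by end_near. Qed.

Lemma real_expansion_main_error (R : realType) (rho Lambda1 a G : R) (N : set nat)
    (tau : nat -> nat -> R) (r : nat) (L : seq R) (p : nat -> R -> {poly R}) :
  rho < a -> Lambda1 < G -> real_expansion rho Lambda1 N tau r L p ->
  exists K : nat -> nat, ((K n)%:R / ln (n%:R : R)) @[n --> \oo] --> +oo /\
    exists m, forall n k, (0 < n)%N -> N n -> (m <= k <= K n)%N ->
      `|tau n k - \sum_(i < r) (\sum_(l <- L) (p i l).[k%:R] * l ^+ k) / n%:R ^+ i|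
      <= r%:R * a ^+ k + G ^+ k / n%:R ^+ r.
Proof.
move=> ra lG [g [h [K [gg hg Koo tauE]]]]; exists K; split=> //.
have := near_forall_ltn (fun i ir => gg i a ir ra).
(* The successor forces [k >= 1], as the expansion requires. *)
move=> /filterI/(_ (hg G lG))[m _ Hm]; exists m.+1 => n k n0 Nn /andP[mk kK].
have [/= gk hk] := Hm k (ltnW mk).
have k1K : (1 <= k <= K n)%N by rewrite kK (leq_trans _ mk).
have := tauE n k Nn k1K; set X := tau n k.
have n1 : 1 <= n%:R :> R by rewrite ler1n.
have -> : \sum_(i < r) (\sum_(l <- L) (p i l).[k%:R] * l ^+ k + g i k) / n%:R ^+ i =
   \sum_(i < r) (\sum_(l <- L) (p i l).[k%:R] * l ^+ k) / n%:R ^+ i +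
   \sum_(i < r) g i k / n%:R ^+ i.
  by rewrite -big_split; apply: eq_bigr => i _; rewrite mulrDl.
set Y := \sum_(i < r) _ / _; set Z := \sum_(i < r) g i k / _ => XYZ.
have Zle : `|Z| <= r%:R * a ^+ k.
  rewrite (le_trans (ler_norm_sum _ _ _)) //.
  apply: (@le_trans _ _ (\sum_(i < r) a ^+ k)); last first.
    by rewrite sumr_const card_ord mulr_natl.
  apply: ler_sum => i _; rewrite normrM (le_trans _ (gk i (ltn_ord i))) //.
  rewrite ler_piMr // normfV normrX normr_nat invf_le1 ?exprn_ege1 //.
  by rewrite exprn_gt0 // ltr0n.
have hle : h k / n%:R ^+ r <= G ^+ k / n%:R ^+ r.
  rewrite ler_wpM2r ?invr_ge0 ?exprn_ge0 //.
  exact: le_trans (ler_norm _) hk.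
have -> : X - Y = Z + (X - (Y + Z)) by lra.
by rewrite (le_trans (ler_normD _ _)) // lerD // (le_trans XYZ).
Qed.

Lemma shift_comb_norm_le (R : realType) (V : {poly R}) (f : nat -> R)
    (b : nat -> R) (k : nat) :
  (forall j, (j < size V)%N -> `|f (k + j)%N| <= b j) ->
  `|shift_comb V f k| <= \sum_(j < size V) `|V`_j| * b j.
Proof.
move=> fb; rewrite (le_trans (ler_norm_sum _ _ _)) // ler_sum // => j _.
by rewrite normrM ler_wpM2l // fb.
Qed.

(** After division by [D^k], the errors of the coefficients are of size [(a / D)^k] and the
    remainder of size [(G / D)^k / n^r]. At [k = even_log C n] both are at most [n ^ (e + o(1))]. *)
Lemma pow_bounded_shift_comb (R : realType) (rho Lambda1 a G C D e : R)
    (N : set nat) (tau : nat -> nat -> R) (r : nat) (L : seq R)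
    (p : nat -> R -> {poly R}) (s : seq R) :
  0 < a -> rho < a -> 0 < G -> Lambda1 < G -> 0 < C -> 0 < D ->
  2 * C * ln (a / D) <= e -> 2 * C * ln (G / D) - r%:R <= e ->
  real_expansion rho Lambda1 N tau r L p ->
  pow_bounded N e (fun n =>
    shift_comb (\prod_(z <- s) ('X - z%:P)) (tau n) (even_log C n)
      / D ^+ even_log C n -
    \sum_(i < r) (n%:R ^+ i)^-1 *
      \sum_(l <- L) (twisted_diffs l s (p i l)).[(even_log C n)%:R] *
        (l / D) ^+ even_log C n).
Proof.
move=> a0 ra G0 lG C0 D0 ae Ge /(real_expansion_main_error ra lG)[K [Koo [m tauE]]].
set V := \prod_(_ <- _) _.
(* The factors [a^j] and [G^j] caused by the shifts [j < size V] are collected in constants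
   independent of [n]. *)
set c1 := \sum_(j < size V) `|V`_j| * r%:R * a ^+ j.
set c2 := \sum_(j < size V) `|V`_j| * G ^+ j.
apply: (@pow_bounded_dom _ _ _ _ (fun n => c1 * (a / D) ^+ even_log C n +
   c2 * ((G / D) ^+ even_log C n * (n%:R ^+ r)^-1))); last first.
  apply: pow_boundedD; apply: pow_boundedZ.
    by apply: pow_bounded_le ae _; apply: pow_bounded_expr_even_log; rewrite ?divr_gt0.
  apply: pow_bounded_le Ge _; apply: pow_boundedM.
    by apply: pow_bounded_expr_even_log; rewrite ?divr_gt0.
  exact: pow_bounded_Xinv.
near=> n => Nn.
have n0 : (0 < n)%N by near: n; exact: nbhs_infty_gt.
have mk : (m <= even_log C n)%N by near: n; exact: (near_even_log_ge m C0).
have kK : (even_log C n + size V <= K n)%N by near: n; exact: (near_even_log_le _ C0 Koo).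
set k := even_log C n in mk kK *.
have Dk : 0 < D ^+ k by rewrite exprn_gt0.
pose f j := tau n j -
  \sum_(i < r) (\sum_(l <- L) (p i l).[j%:R] * l ^+ j) / n%:R ^+ i.
have -> : shift_comb V (tau n) k / D ^+ k -
    \sum_(i < r) (n%:R ^+ i)^-1 *
      \sum_(l <- L) (twisted_diffs l s (p i l)).[k%:R] * (l / D) ^+ k =
    shift_comb V f k / D ^+ k.
  have -> : shift_comb V f k = shift_comb V (tau n) k -
      \sum_(i < r) (n%:R ^+ i)^-1 *
        \sum_(l <- L) (twisted_diffs l s (p i l)).[k%:R] * l ^+ k.
    have -> : shift_comb V f k = shift_comb V (tau n) k +
        shift_comb V (fun j => -1 * \sum_(i < r) (n%:R ^+ i)^-1 *
           \sum_(l <- L) (p i l).[j%:R] * l ^+ j) k.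
      rewrite -shift_combD; apply: eq_bigr => j _; congr (_ * _).
      rewrite mulN1r; congr (_ - _); apply: eq_bigr => i _; exact: mulrC.
    rewrite shift_combZ mulN1r; congr (_ - _).
    rewrite shift_comb_sum; apply: eq_bigr => i _; rewrite shift_combZ.
    congr (_ * _); rewrite shift_comb_sum; apply: eq_bigr => l _.
    exact: shift_comb_prod.
  rewrite mulrBl; congr (_ - _); rewrite mulr_suml; apply: eq_bigr => i _.
  rewrite -mulrA; congr (_ * _); rewrite mulr_suml; apply: eq_bigr => l _.
  by rewrite expr_div_n mulrA.
have fle j : (j < size V)%N -> `|f (k + j)%N| <=
    (r%:R * a ^+ j) * a ^+ k + G ^+ j * (G ^+ k / n%:R ^+ r).
  move=> js; rewrite -mulrA -exprD mulrA -exprD [(j + k)%N]addnC; apply: tauE => //.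
  rewrite (leq_trans mk) ?leq_addr //= (leq_trans _ kK) // leq_add2l.
  exact: ltnW.
have := shift_comb_norm_le fle.
under eq_bigr do rewrite mulrDr !(mulrA `|_|).
rewrite big_split /= -!mulr_suml -/c1 -/c2 => le12.
rewrite normrM normfV (ger0_norm (ltW Dk)) ler_pdivrMr // (le_trans le12) //.
rewrite (le_trans _ (ler_wpM2r (ltW Dk) (ler_norm _))) // !expr_div_n.
have Dk0 : D ^+ k != 0 by rewrite gt_eqF.
rewrite le_eqVlt; apply/orP; left; apply/eqP; rewrite [RHS]mulrDl.
congr (_ + _); first by rewrite -[RHS]mulrA divfK.
by rewrite -[RHS]mulrA [G ^+ k / D ^+ k / _]mulrAC divfK.
Unshelve. all: by end_near. Qed.

(** * Multiple roots and interpolation *)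

(** Powers of products of linear factors are kept as lists of roots, so that [shift_comb_prod]
    applies and [count_mem] reads off multiplicities. *)
Definition seq_pow (T : Type) (m : nat) (s : seq T) : seq T := flatten (nseq m s).

Lemma prod_seq_pow (R : comNzRingType) (T : Type) (m : nat) (s : seq T) (F : T -> R) :
  \prod_(x <- seq_pow m s) F x = (\prod_(x <- s) F x) ^+ m.
Proof.
rewrite /seq_pow; elim: m => [|m IH] /=; first by rewrite big_nil.
by rewrite big_cat exprS IH.
Qed.

Lemma count_seq_pow (T : eqType) (m : nat) (s : seq T) (x : T) :
  count_mem x (seq_pow m s) = (m * count_mem x s)%N.
Proof. by elim: m => //= m IH; rewrite count_cat [count_mem x (flatten _)]IH mulSn. Qed.

Lemma shift_comb_polyD (R : nzRingType) (A B : {poly R}) (h : nat -> R) (k : nat) :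
  shift_comb (A + B) h k = shift_comb A h k + shift_comb B h k.
Proof.
rewrite (shift_combE _ _ (size_polyD A B)).
rewrite (shift_combE _ _ (leq_maxl (size A) (size B))).
rewrite (shift_combE _ _ (leq_maxr (size A) (size B))).
by rewrite -big_split; apply: eq_bigr => j _; rewrite coefD mulrDl.
Qed.

Lemma shift_comb_polyZ (R : nzRingType) (c : R) (A : {poly R}) (h : nat -> R)
    (k : nat) :
  shift_comb (c *: A) h k = c * shift_comb A h k.
Proof.
rewrite (shift_combE _ _ (size_scale_leq c A)) mulr_sumr.
by apply: eq_bigr => j _; rewrite coefZ mulrA.
Qed.

(** Polynomials in [ln n] are [n ^ o(1)], so the first order that does not vanish decides the
    size. *)
Lemma pow_bounded_poly_sum (R : realType) (N : set nat) (C : R) (r m : nat)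
    (q : nat -> {poly R}) : 0 < C ->
  (forall i, (i < r)%N -> (i < m)%N -> q i = 0) ->
  pow_bounded N (- m%:R)
    (fun n => \sum_(i < r) (n%:R ^+ i)^-1 * (q i).[(even_log C n)%:R]).
Proof.
move=> C0 q0; apply: pow_bounded_sum => i _.
have [im|mi] := ltnP i m.
  apply: pow_bounded_dom (pow_bounded0 N _); near=> n => _.
  by rewrite q0 // horner0 mulr0.
rewrite -[- m%:R]addr0; apply: pow_boundedM; last exact: pow_bounded_poly_even_log.
by apply: pow_bounded_le (pow_bounded_Xinv N i); rewrite lerN2 ler_nat.
Unshelve. all: by end_near. Qed.

(* The case [T = n ^ (- 1 / (2 J))] of [t <= T + T ^ (1 - J) t ^ J]. *)
Lemma pow_interpolation (R : realType) (J n : nat) (t : R) :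
  (0 < J)%N -> (0 < n)%N -> 0 <= t ->
  t <= n%:R `^ (- (2 * J%:R)^-1) + n%:R `^ 2^-1 * t ^+ J.
Proof.
move=> J0 n0 t0; set T := _ `^ (- _).
have nR : 0 < n%:R :> R by rewrite ltr0n.
have T0 : 0 < T by rewrite powR_gt0.
have T1 : T <= 1.
  rewrite -(powRr0 n%:R) ler_powR ?ler1n // oppr_le0 invr_ge0 mulr_ge0 //.
(* The coefficient [n ^ (1 / 2)] is [T ^ (- J)], which dominates [T ^ (1 - J)] because [T <= 1]. *)
have TJ : n%:R `^ 2^-1 * T ^+ J = 1.
  rewrite -powR_mulrn ?ltW // -powRrM -powRD; last by rewrite (gt_eqF nR) implybT.
  rewrite (_ : _ + _ = 0) ?powRr0 //; field.
  by rewrite pnatr_eq0 -lt0n.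
have [tT|Tt] := leP t T.
  by rewrite (le_trans tT) // lerDl mulr_ge0 ?powR_ge0 ?exprn_ge0.
have TJt : T ^+ J * t <= t ^+ J.
  case: (J) J0 => // J' _; rewrite exprS exprSr ler_wpM2r // -[leRHS]mul1r.
  by rewrite ler_pM ?exprn_ge0 ?(ltW T0) // lerXn2r // ?nnegrE ltW.
rewrite ler_wpDl ?(ltW T0) // -[leLHS]mul1r -[in leLHS]TJ -mulrA.
by rewrite ler_wpM2l ?powR_ge0.
Qed.

(** This bound depends on the model. It may serve as a multiplicity of roots, but must not enter the
    exponents of the theorem. *)
Lemma size_coefficients_le (R : nzRingType) (T : eqType) (r : nat) (L : seq T)
    (p : nat -> T -> {poly R}) :
  exists2 J, (0 < J)%N & forall i l, (i < r)%N -> l \in L -> (size (p i l) <= J)%N.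
Proof.
exists (\max_(i < r) \max_(l <- L) size (p i l)).+1 => // i l ir lL.
rewrite ltnW // ltnS (leq_trans _ (leq_bigmax (Ordinal ir))) //=.
by rewrite (big_rem l) //= leq_maxl.
Qed.

(** * Degrees of the coefficients *)

Lemma pow_bounded_norm (R : realType) (N : set nat) (b : R) (f : nat -> R) :
  pow_bounded N b f -> pow_bounded N b (fun n => `|f n|).
Proof. by apply: pow_bounded_dom; near=> n => _; rewrite normr_id.
Unshelve. all: by end_near. Qed.

(** The bound says that [(X - l)^(2 i + 2)] annihilates [p i l], and is proved by strong induction
    on [i]. The two hypotheses on [C] make all expansion errors, relative to [|l|^k], at most
    [n ^ (- (m + 2) + o(1))]. *)
Lemma base_degree_le (R : realType) (rho Lambda1 a G C : R) (N : set nat)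
    (M : forall n, matrix_space R n) (r m : nat) (L : seq R)
    (p : nat -> R -> {poly R}) (l : R) :
  0 < rho -> rho < a -> 0 < G -> Lambda1 < G -> 0 < C ->
  bounded_matrix_model rho Lambda1 N M -> uniq L ->
  real_expansion rho Lambda1 N
    (fun n k => expect (M n) (fun A => \tr (A ^+ k))) r L p ->
  (forall z, z \in L -> z != 0) -> l \in L ->
  2 * C * ln (a / `|l|) <= - m.+2%:R ->
  2 * C * ln (G / `|l|) - r%:R <= - m.+2%:R ->
  forall i, (i < m)%N -> (i < r)%N -> (size (p i l) <= 2 * i.+1)%N.
Proof.
move=> r0 ra G0 lG C0 [Npos Noo spec] uL expn nz lL aE GE.
set tau := (fun n k => _) in expn; set D := `|l| in aE GE *.
have a0 : 0 < a by rewrite (lt_trans r0).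
have l0 : l != 0 by apply: nz.
have D0 : 0 < D by rewrite normr_gt0.
have [J J0 pJ] := size_coefficients_le r L p.
(* All multiplicities are even, so [V j >= 0]; the multiplicity [2 J] annihilates every base other
   than [l]. *)
pose s j := seq_pow (2 * j) [:: l] ++ seq_pow (2 * J) (rem l L).
pose V j := \prod_(z <- s j) ('X - z%:P).
pose w : {poly R} := \prod_(z <- rem l L) ('X - z%:P).
pose k n := even_log C n.
pose u j n := shift_comb (V j) (tau n) (k n) / D ^+ k n.
pose q j i := twisted_diffs l (s j) (p i l).
have Vx j x : (V j).[x] = ((x - l) ^+ 2) ^+ j * (w.[x] ^+ J) ^+ 2.
  rewrite /V /s big_cat hornerM /= !prod_seq_pow -/w big_seq1.
  by rewrite !horner_exp hornerXsubC -!exprM [(J * 2)%N]mulnC.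
have qs j i : size (q j i) = (size (p i l) - 2 * j)%N.
  rewrite /q size_twisted_diffs // count_cat !count_seq_pow /= eqxx muln1.
  by rewrite (count_memPn _) ?muln0 ?addn0 // mem_rem_uniq // !inE eqxx.
have uE j : pow_bounded N (- m.+2%:R)
    (fun n => u j n - \sum_(i < r) (n%:R ^+ i)^-1 * (q j i).[(k n)%:R]).
  have := pow_bounded_shift_comb (s j) a0 ra G0 lG C0 D0 aE GE expn.
  apply: pow_bounded_dom; near=> n => _; rewrite le_eqVlt; apply/orP; left.
  apply/eqP; congr (`|_ - _|); apply: eq_bigr => i _; congr (_ * _).
  rewrite (bigD1_seq l) //= -/(k n) expr_div_n.
  (* The exponent is even, so the sign of [l] disappears and normalization by [|l|^k] leaves just
     the polynomial. *)
  have -> : l ^+ k n / D ^+ k n = 1.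
    rewrite /D -normrX ger0_norm ?exprn_even_ge0 ?odd_even_log //.
    by rewrite divff // expf_eq0 (negPf l0) andbF.
  rewrite mulr1 big_seq_cond big1 ?addr0 // => l' /andP[l'L l'l].
  suff -> : twisted_diffs l' (s j) (p i l') = 0 by rewrite horner0 mul0r.
  apply/eqP; rewrite -size_poly_eq0 size_twisted_diffs ?nz // subn_eq0.
  rewrite (leq_trans (pJ i l' (ltn_ord i) l'L)) // count_cat !count_seq_pow.
  rewrite (count_uniq_mem _ (rem_uniq _ uL)) mem_rem_uniq // !inE l'l l'L.
  by rewrite (leq_trans _ (leq_addl _ _)) // muln1 leq_pmull.

have Dk n : 0 < D ^+ k n by rewrite exprn_gt0.
have rD : pow_bounded N (1 - m.+2%:R) (fun n => n%:R * (rho / D) ^+ k n).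
  apply: (pow_boundedM (pow_bounded_natr N)).
  apply: (pow_bounded_le _ (pow_bounded_expr_even_log N C0 (divr_gt0 r0 D0))).
  apply: le_trans aE; rewrite ler_wpM2l ?mulr_ge0 ?(ltW C0) //.
  by rewrite ler_ln ?posrE ?divr_gt0 // ler_pM2r ?invr_gt0 // ltW.
have V0 j x : 0 <= (V j).[x].
  by rewrite Vx mulr_ge0 ?sqr_ge0 // exprn_ge0 // sqr_ge0.
have spec' n : N n -> forall A, A \in atoms (M n) -> forall z,
    eigenvalue (cmx A) z ->
    (cball rho 0 `|` real_segment (- Lambda1) Lambda1) z by move/spec.
elim/ltn_ind => i IH im ir.
have pIH i' : (i' < i)%N -> (size (p i' l) <= 2 * i'.+1)%N.
  by move=> i'i; apply: IH => //; [exact: ltn_trans im|exact: ltn_trans ir].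
have q0 j i' : (i' < i)%N -> (i <= j)%N -> q j i' = 0.
  move=> i'i ij; apply/eqP; rewrite -size_poly_eq0 qs subn_eq0.
  by rewrite (leq_trans (pIH i' i'i)) // leq_mul2l /= (leq_trans i'i).
(* By induction [V i] annihilates all orders below [i]. *)
have ui : pow_bounded N (- i%:R) (u i).
  apply: (@pow_bounded_dom _ _ _ _ (fun n =>
      (u i n - \sum_(i' < r) (n%:R ^+ i')^-1 * (q i i').[(k n)%:R]) +
      \sum_(i' < r) (n%:R ^+ i')^-1 * (q i i').[(k n)%:R])).
    by near=> n => _; rewrite subrK.
  apply: pow_boundedD.
    by apply: pow_bounded_le (uE i); rewrite lerN2 ler_nat (leq_trans (ltnW im)) // -addn2 leq_addr.
  by apply: pow_bounded_poly_sum => // i' _ i'i; apply: q0.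
(* With multiplicity at least [2 J] at [l] too, only the expansion error remains. *)
have uJ : pow_bounded N (- m.+2%:R) (u (i + J)%N).
  apply: pow_bounded_dom (uE (i + J)%N); near=> n => _.
  rewrite big1 ?subr0 // => i' _; rewrite (_ : q _ _ = 0) ?horner0 ?mulr0 //.
  apply/eqP; rewrite -size_poly_eq0 qs subn_eq0.
  by rewrite (leq_trans (pJ _ _ (ltn_ord i') lL)) // (leq_trans (leq_addl i J)) // leq_pmull.
pose eta : R := (2 * J%:R)^-1.
have JR : 1 <= J%:R :> R by rewrite ler1n.
have eta0 : 0 < eta by rewrite invr_gt0 mulr_gt0 // (lt_le_trans _ JR).
have eta2 : eta <= 2^-1 by rewrite lef_pV2 ?posrE ?mulr_gt0 ?(lt_le_trans _ JR) // ler_peMr.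
have [ci ci0 Vi] := poly_ball_bound (V i) (ltW r0).
have [cJ cJ0 VJ] := poly_ball_bound (V (i + J)%N) (ltW r0).
have [c1 c10 V1] := poly_ball_bound (V i.+1) (ltW r0).
(* The bound for [u i.+1]: the two terms of the interpolation and the contributions of the ball. *)
pose X n := `|n%:R `^ (- eta) * u i n| + `|n%:R `^ 2^-1 * u (i + J)%N n| +
  n%:R * (rho / D) ^+ k n * (n%:R `^ (- eta) * ci + n%:R `^ 2^-1 * cJ + c1).
have imR : i%:R <= m%:R :> R by rewrite ler_nat ltnW.
have mR : m.+2%:R = m%:R + 2 :> R by rewrite -addn2 natrD.
have Xb : pow_bounded N (- i%:R - eta) X.
  rewrite mR in rD uJ.
  apply: pow_boundedD; first apply: pow_boundedD.
  - rewrite addrC; apply/pow_bounded_norm/pow_boundedM => //.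
    exact: pow_bounded_powR.
  - apply/pow_bounded_norm; apply: (@pow_bounded_le _ _ (2^-1 - (m%:R + 2))).
      by lra.
    by apply: pow_boundedM => //; exact: pow_bounded_powR.
  (* Starting from [- (m + 2)], a factor [n] is lost to the number of eigenvalues and [n ^ (1 / 2)]
     to the interpolation. What remains, [- m - 1 / 2], is at most [- i - eta]. *)
  - apply: (@pow_bounded_le _ _ (1 - (m%:R + 2) + 2^-1)); first by lra.
    apply: pow_boundedM => //; apply: pow_boundedD; first apply: pow_boundedD.
    + rewrite -[2^-1]addr0; apply: pow_boundedM; last exact: pow_bounded_cst.
      by apply: pow_bounded_le (pow_bounded_powR _ _); lra.
    + rewrite -[X in pow_bounded _ X]addr0; apply: pow_boundedM.
        exact: pow_bounded_powR.
      exact: pow_bounded_cst.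
    + by apply: pow_bounded_le (pow_bounded_cst _ _).
have u1 : pow_bounded N (- i%:R - eta) (u i.+1).
  apply: pow_bounded_dom Xb; near=> n => Nn.
  have n0 : (0 < n)%N by near: n; exact: nbhs_infty_gt.
  have ek : ~~ odd (k n) by rewrite odd_even_log.
  have Dk0 : D ^+ k n != 0 by rewrite gt_eqF.
  have T0 : 0 <= n%:R `^ (- eta) :> R by rewrite powR_ge0.
  have c0 : 0 <= n%:R `^ 2^-1 :> R by rewrite powR_ge0.
  have nk0 : 0 <= n%:R * (rho / D) ^+ k n :> R.
    by rewrite mulr_ge0 // exprn_ge0 // divr_ge0 // ltW.
  (* Positivity of [V i.+1] bounds [u i.+1] from below. *)
  have := shift_comb_expect_ge (spec' n Nn) (ltW r0) ek c10 V1 (V0 i.+1).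
  rewrite -(pmulr_rge0 _ (_ : 0 < (D ^+ k n)^-1)) ?invr_gt0 // mulrDr.
  rewrite -/(tau n) [X in X + _]mulrC -/(u i.+1 n).
  have -> : (D ^+ k n)^-1 * (n%:R * (rho ^+ k n * c1)) =
      n%:R * (rho / D) ^+ k n * c1 by rewrite expr_div_n; move: (D ^+ k n)^-1 (rho ^+ k n) => ? ?; ring.
  move=> low.
  (* The upper bound comes from positivity of the interpolating combination minus [V i.+1]. Its
     coefficients depend on [n], so its bound on the ball is kept explicit. *)
  have Wc z : `|z| <= rho%:C -> `|(map_poly (real_complex R)
      (n%:R `^ (- eta) *: V i + n%:R `^ 2^-1 *: V (i + J)%N - V i.+1)).[z]| <=
      (n%:R `^ (- eta) * ci + n%:R `^ 2^-1 * cJ + c1)%:C.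
    move=> zr; rewrite rmorphB rmorphD /= !map_polyZ !hornerE /=.
    rewrite !rmorphD !rmorphM /= (le_trans (ler_normB _ _)) // lerD ?V1 //.
    rewrite (le_trans (ler_normD _ _)) // lerD // normrM ger0_norm ?ler0c //.
      by rewrite ler_wpM2l ?ler0c // Vi.
    by rewrite ler_wpM2l ?ler0c // VJ.
  have W0 x : 0 <= (n%:R `^ (- eta) *: V i + n%:R `^ 2^-1 *: V (i + J)%N - V i.+1).[x].
    rewrite !hornerE !Vx exprD [_ ^+ i.+1]exprS.
    have := pow_interpolation J0 n0 (sqr_ge0 (x - l)); rewrite -/eta.
    set t := (x - l) ^+ 2 => tle.
    have W1 : 0 <= t ^+ i * (w.[x] ^+ J) ^+ 2.
      by rewrite mulr_ge0 ?sqr_ge0 // exprn_ge0 // sqr_ge0.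
    move: tle W1; move: (t ^+ i) (t ^+ J) (_ ^+ 2) (_ `^ _) (_ `^ _) => ti tJ W T c.
    by rewrite -subr_ge0 => tle /(mulr_ge0 tle); clear; move: t => t; lra.
  have Z0 : 0 <= n%:R `^ (- eta) * ci + n%:R `^ 2^-1 * cJ + c1.
    by rewrite !addr_ge0 // mulr_ge0.
  have := shift_comb_expect_ge (spec' n Nn) (ltW r0) ek Z0 Wc W0.
  rewrite -[- V i.+1]scaleN1r !shift_comb_polyD !shift_comb_polyZ -/(tau n) mulN1r.
  rewrite -(pmulr_rge0 _ (_ : 0 < (D ^+ k n)^-1)) ?invr_gt0 //.
  set Z := n%:R `^ (- eta) * ci + _ + _.
  have -> : forall x y z : R, (D ^+ k n)^-1 *
     (n%:R `^ (- eta) * x + n%:R `^ 2^-1 * y - z + n%:R * (rho ^+ k n * Z)) =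
     n%:R `^ (- eta) * (x / D ^+ k n) + n%:R `^ 2^-1 * (y / D ^+ k n) - z / D ^+ k n
     + n%:R * (rho / D) ^+ k n * Z.
    by move=> x y z; rewrite expr_div_n; move: (D ^+ k n)^-1 (rho ^+ k n) => ? ?; ring.
  rewrite -/(u i n) -/(u (i + J)%N n) -/(u i.+1 n) => up.
  have X0 : 0 <= X n.
    by rewrite /X -/Z !addr_ge0 // mulr_ge0.
  have Z1 : n%:R * (rho / D) ^+ k n * c1 <= n%:R * (rho / D) ^+ k n * Z.
    by rewrite ler_wpM2l // lerDr addr_ge0 // mulr_ge0.
  rewrite (ger0_norm X0) ler_norml /X -/Z.
  move: low up Z1; move: (_ * _ * c1) (_ * _ * Z) => z1 z.
  move: (_ * u i n) (_ * u (i + J)%N n) (u i.+1 n) => A B x; clear.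
  by have := ler_norm A; have := ler_norm B; have := normr_ge0 A;
     have := normr_ge0 B; lra.
have qi : pow_bounded N (- eta) (fun n => (q i.+1 i).[(k n)%:R]).
  (* Removing order [i] leaves only orders above [i], since the lower ones vanish. Hence order [i]
     of [u i.+1] can be isolated and then multiplied by [n^i]. *)
  pose q' i' := if i' == i then 0 else q i.+1 i'.
  have q'b : pow_bounded N (- i.+1%:R)
      (fun n => \sum_(i' < r) (n%:R ^+ i')^-1 * (q' i').[(k n)%:R]).
    apply: pow_bounded_poly_sum => // i' _; rewrite ltnS leq_eqVlt /q'.
    by case: eqP => //= _ i'i; apply: q0.
  have iS : i.+1%:R = i%:R + 1 :> R by rewrite natr1.
  rewrite iS in q'b.
  rewrite (_ : - eta = i%:R + (- i%:R - eta)); last by rewrite addrA subrr add0r.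
  apply: (@pow_bounded_dom _ _ _ _ (fun n => n%:R `^ i%:R *
     (u i.+1 n + -1 * (u i.+1 n -
        \sum_(i' < r) (n%:R ^+ i')^-1 * (q i.+1 i').[(k n)%:R]) +
      -1 * \sum_(i' < r) (n%:R ^+ i')^-1 * (q' i').[(k n)%:R]))).
    near=> n => _; have n0 : n%:R != 0 :> R.
      by rewrite pnatr_eq0 -lt0n; near: n; exact: nbhs_infty_gt.
    have -> : \sum_(i' < r) (n%:R ^+ i')^-1 * (q i.+1 i').[(k n)%:R] =
        (n%:R ^+ i)^-1 * (q i.+1 i).[(k n)%:R] +
        \sum_(i' < r) (n%:R ^+ i')^-1 * (q' i').[(k n)%:R].
      rewrite (bigD1 (Ordinal ir)) //= [in RHS](bigD1 (Ordinal ir)) //=.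
      rewrite {1}/q' eqxx horner0 mulr0 add0r; congr (_ + _).
      by apply: eq_bigr => i'; rewrite -val_eqE /q' /= => /negPf ->.
    set S := \sum_(_ < r) _; rewrite powR_mulrn // !mulN1r opprB addrCA subrr.
    rewrite addr0 addrK mulVKf // expf_eq0 (negPf n0) andbF.
    by [].
  apply: pow_boundedM; first exact: pow_bounded_powR.
  apply: pow_boundedD; first apply: pow_boundedD => //.
    apply: pow_boundedZ; apply: pow_bounded_le (uE i.+1); rewrite mR; lra.
  by apply: pow_boundedZ; apply: pow_bounded_le q'b; lra.
(* A polynomial in [k n] that decays like [n ^ (- eta)] is 0, so [V i.+1] annihilates [p i l]. *)
have := pow_bounded_poly_even_log_eq0 Noo C0 _ qi; rewrite oppr_lt0 eta0.
by move=> /(_ isT)/eqP; rewrite -size_poly_eq0 qs subn_eq0.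
Unshelve. all: by end_near. Qed.

(** * Eigenvalues far from the bases *)

Lemma prod_ge_exp (R : realDomainType) (I : eqType) (s : seq I) (d : R) (F : I -> R) :
  0 <= d -> (forall x, x \in s -> d <= F x) -> d ^+ size s <= \prod_(x <- s) F x.
Proof.
move=> d0; elim: s => [|i s IH] dF; first by rewrite big_nil.
rewrite big_cons exprS ler_pM ?exprn_ge0 ?dF ?mem_head // IH // => x xs.
by rewrite dF // in_cons xs orbT.
Qed.

Lemma dist_lower_bound (R : realFieldType) (s : seq R) (a : R) : a \notin s ->
  exists2 d : R, 0 < d & forall l, l \in s -> d <= `|a - l|.
Proof.
elim: s => [|b s IH]; first by exists 1.
rewrite in_cons negb_or => /andP[ab /IH[d d0 ds]].
exists (Num.min d `|a - b|); first by rewrite lt_min d0 normr_gt0 subr_eq0.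
move=> l; rewrite in_cons => /predU1P[->|/ds dl]; first by rewrite ge_min lexx orbT.
by rewrite ge_min dl.
Qed.

(* At most one factor can be small, because the points of [s] are distinct. *)
Lemma prod_dist_ge (R : realFieldType) (s : seq R) : uniq s ->
  exists2 c : R, 0 < c & forall x v : R, 0 <= v -> v <= 1 ->
    (forall l, l \in s -> v <= `|x - l|) -> c * v <= \prod_(l <- s) `|x - l|.
Proof.
elim: s => [|a s IH] /=; first by exists 1 => // x v _ v1 _; rewrite big_nil mul1r.
move=> /andP[/dist_lower_bound[d d0 ds] /IH[c c0 cs]].
have d2 : 0 < d / 2 by rewrite divr_gt0.
exists (Num.min (d / 2 * c) ((d / 2) ^+ size s)).
  by rewrite lt_min mulr_gt0 //= exprn_gt0.
move=> x v v0 v1 vs; rewrite big_cons.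
have vs' l : l \in s -> v <= `|x - l| by move=> ls; rewrite vs // in_cons ls orbT.
have [dx|xd] := leP (d / 2) `|x - a|.
  apply: (@le_trans _ _ (d / 2 * c * v)); first by rewrite ler_wpM2r // ge_min lexx.
  rewrite -mulrA ler_pM ?(ltW d2) //; last exact: cs.
  by rewrite mulr_ge0 // ltW.
apply: (@le_trans _ _ ((d / 2) ^+ size s * v)).
  by rewrite ler_wpM2r // ge_min lexx orbT.
rewrite mulrC ler_pM ?exprn_ge0 ?(ltW d2) ?vs ?mem_head //.
apply: prod_ge_exp => [|l /ds dl]; first exact: ltW.
have := ler_normB (x - l) (x - a).
rewrite (_ : x - l - (x - a) = a - l); last by ring.
by move=> /(le_trans dl); lra.
Qed.

(** Bases of modulus at least [rho + eps / 2] get multiplicity [2 m], which is independent of the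
    model and makes [V] at least a constant times [1 / n] at the counted eigenvalues. The smaller
    bases may get the model-dependent multiplicity [2 J]: they are at distance at least [eps / 2]
    from every counted eigenvalue, so this costs only a constant. *)
Lemma Eout_pow_bounded (R : realType) (rho Lambda1 eps alpha G C theta : R)
    (N : set nat) (M : forall n, matrix_space R n) (r m : nat) (L : seq R)
    (p : nat -> R -> {poly R}) (S : set R[i]) :
  0 < rho -> 0 < eps -> 0 < G -> Lambda1 < G -> 0 < C -> (0 < m <= r)%N ->
  bounded_matrix_model rho Lambda1 N M -> uniq L ->
  real_expansion rho Lambda1 N
    (fun n k => expect (M n) (fun A => \tr (A ^+ k))) r L p ->
  (forall l, l \in L -> rho < `|l| <= Lambda1) ->
  (forall l, l \in L -> S l%:C) ->
  (forall i l, (i < m)%N -> l \in L -> rho + eps / 2 <= `|l| ->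
     (size (p i l) <= 2 * m)%N) ->
  2 * C * ln ((rho + eps / 4) / (rho + eps)) <= - (alpha + 3) ->
  2 * C * ln (G / (rho + eps)) - m%:R <= - (alpha + 3) ->
  theta <= (2 * m%:R)^-1 ->
  pow_bounded N (- (alpha + 1)) (fun n =>
    Eout (M n) (cball (rho + eps) 0 `|` cball_set (n%:R `^ (- theta)) S)).
Proof.
move=> r0 e0 G0 lG C0 /andP[m0 mr] [Npos Noo spec] uL expn Ll LS pm aE GE tm.
set tau := (fun n k => _) in expn.
set F := rho + eps in aE GE *; pose a := rho + eps / 4; pose B := rho + eps / 2.
have e4 : 0 < eps / 4 by rewrite divr_gt0.
have e2 : 0 < eps / 2 by rewrite divr_gt0.
have ra : rho < a by rewrite ltrDl.
have a0 : 0 < a by rewrite (lt_trans r0).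
have F0 : 0 < F by rewrite addr_gt0.
have rF : rho < F by rewrite ltrDl.
have nz l : l \in L -> l != 0.
  by move=> /Ll/andP[rl _]; rewrite -normr_gt0 (lt_trans r0).
have [J J0 pJ] := size_coefficients_le r L p.
pose Lb := [seq l <- L | B <= `|l|]; pose Ls := [seq l <- L | ~~ (B <= `|l|)].
pose s := seq_pow (2 * m) Lb ++ seq_pow (2 * J) Ls.
pose V := \prod_(z <- s) ('X - z%:P).
pose k n := even_log C n.
have Vx x : V.[x] = (\prod_(z <- Lb) `|x - z|) ^+ (2 * m) *
    (\prod_(z <- Ls) `|x - z|) ^+ (2 * J).
  have sq (t : seq R) j : (\prod_(z <- t) ('X - z%:P)).[x] ^+ (2 * j) =
      (\prod_(z <- t) `|x - z|) ^+ (2 * j).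
    rewrite horner_prod -normr_prod -normrX ger0_norm.
      by congr (_ ^+ _); apply: eq_bigr => z _; rewrite hornerXsubC.
    by rewrite exprn_even_ge0 // mul2n odd_double.
  by rewrite /V /s big_cat hornerM /= !prod_seq_pow !horner_exp !sq.
have V0 x : 0 <= V.[x].
  by rewrite Vx mulr_ge0 // exprn_ge0 // prodr_ge0 // => z _.
have kill i l : (i < m)%N -> l \in L -> twisted_diffs l s (p i l) = 0.
  move=> im lL; apply/eqP; rewrite -size_poly_eq0 size_twisted_diffs ?nz // subn_eq0.
  rewrite count_cat !count_seq_pow !(count_uniq_mem _ (filter_uniq _ uL)).
  rewrite !mem_filter lL !andbT; case: (boolP (B <= `|l|)) => bl /=.
    by rewrite muln1 (leq_trans (pm i l im lL bl)) // leq_addr.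
  rewrite muln1 muln0 add0n (leq_trans (pJ i l (leq_trans im mr) lL)) //.
  by rewrite leq_pmull.
have aE' : 2 * C * ln (a / F) <= - (alpha + 3) by [].
have GE' : 2 * C * ln (G / F) - r%:R <= - (alpha + 3).
  by apply: le_trans GE; rewrite lerD2l lerN2 ler_nat.
have expE := pow_bounded_shift_comb s a0 ra G0 lG C0 F0 aE' GE' expn.
have main : pow_bounded N (- (alpha + 3)) (fun n =>
    \sum_(i < r) (n%:R ^+ i)^-1 *
      \sum_(l <- L) (twisted_diffs l s (p i l)).[(k n)%:R] * (l / F) ^+ k n).
  apply: pow_bounded_sum => i _; have [im|mi] := ltnP i m.
    apply: pow_bounded_dom (pow_bounded0 N _); near=> n => _.
    rewrite big_seq big1 ?mulr0 // => l lL.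
    by rewrite kill // horner0 mul0r.
  (* The orders [i >= m] are not annihilated, but the factor [n ^ (- m)] outweighs [(G / F)^k]. *)
  apply: pow_bounded_le GE _; rewrite addrC; apply: pow_boundedM.
    by apply: pow_bounded_le (pow_bounded_Xinv N i); rewrite lerN2 ler_nat.
  apply: pow_bounded_sum => l lL; rewrite -[X in pow_bounded _ X]add0r.
  apply: pow_boundedM; first exact: pow_bounded_poly_even_log.
  apply: pow_bounded_dom (pow_bounded_expr_even_log N C0 (divr_gt0 G0 F0)).
  near=> n => _; rewrite !normrX lerXn2r // ?nnegrE // !normrM.
  rewrite ler_wpM2r // (gtr0_norm G0) ltW // (le_lt_trans _ lG) //.
  by have /andP[] := Ll l lL.
(* The number of eigenvalues costs one of the three spare powers of [n]. *)
have rE : pow_bounded N (- (alpha + 2)) (fun n => n%:R * (rho / F) ^+ k n).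
  rewrite (_ : - (alpha + 2) = 1 + - (alpha + 3)); last by lra.
  apply: (pow_boundedM (pow_bounded_natr N)).
  apply: (pow_bounded_le _ (pow_bounded_expr_even_log N C0 (divr_gt0 r0 F0))).
  apply: le_trans aE'; rewrite ler_wpM2l ?mulr_ge0 ?(ltW C0) //.
  by rewrite ler_ln ?posrE ?divr_gt0 // ler_pM2r ?invr_gt0 // ltW.
have [cV cV0 VC] := poly_ball_bound V (ltW r0).
pose U n := shift_comb V (tau n) (k n) / F ^+ k n + cV * (n%:R * (rho / F) ^+ k n).
have Ub : pow_bounded N (- (alpha + 2)) U.
  apply: pow_boundedD; last exact: pow_boundedZ.
  have := pow_boundedD expE main; rewrite -/V => Em.
  apply: pow_bounded_le (_ : - (alpha + 3) <= _) _; first by rewrite lerN2 lerD2l ler_nat.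
  by apply: pow_bounded_dom Em; near=> n => _; rewrite subrK.
have [c c0 cLb] := prod_dist_ge (filter_uniq (fun l => B <= `|l|) uL).
pose kappa := c ^+ (2 * m) * ((eps / 2) ^+ size Ls) ^+ (2 * J).
have kappa0 : 0 < kappa by rewrite mulr_gt0 // exprn_gt0 // exprn_gt0.
apply: (@pow_bounded_dom _ _ _ _ (fun n => kappa^-1 * (n%:R * U n))); last first.
  (* Division by the lower bound [kappa / n] of [V] costs another power of [n]. *)
  apply: pow_boundedZ; rewrite (_ : - (alpha + 1) = 1 + - (alpha + 2)); last by lra.
  exact: (pow_boundedM (pow_bounded_natr N)).
near=> n => Nn; set S' := _ `|` _.
have n0 : (0 < n)%N by near: n; exact: nbhs_infty_gt.
have nR : 0 < n%:R :> R by rewrite ltr0n.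
have Fk : 0 < F ^+ k n by rewrite exprn_gt0.
have Vlow x : - Lambda1 <= x <= Lambda1 -> ~ S' x%:C ->
    F ^+ k n * (kappa * n%:R^-1) <= x ^+ k n * V.[x].
  move=> _ xS; have normC y : `|y%:C| = `|y|%:C :> R[i].
    by rewrite normc_def /= expr0n addr0 sqrtr_sqr.
  have Fx : F < `|x|.
    rewrite ltNge; apply/negP => xF; apply: xS; left.
    by rewrite /cball /= subr0 normC lecR.
  (* A smaller [theta] only enlarges the excluded neighbourhood, so the extreme exponent [1 / (2 m)]
     may be used; it makes [v^(2 m)] equal to [1 / n]. *)
  have xl l : l \in L -> n%:R `^ (- (2 * m%:R)^-1) <= `|x - l|.
    move=> lL; rewrite leNgt; apply/negP => xl; apply: xS; right.
    exists l%:C; first exact: LS.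
    rewrite /cball /= -rmorphB normC lecR (le_trans (ltW xl)) //.
    by rewrite ler_powR ?ler1n // lerN2.
  set v := n%:R `^ _ in xl.
  have v0 : 0 <= v by rewrite powR_ge0.
  have v1 : v <= 1.
    by rewrite -(powRr0 n%:R) ler_powR ?ler1n // oppr_le0 invr_ge0 mulr_ge0.
  have vm : v ^+ (2 * m) = n%:R^-1.
    rewrite -powR_mulrn // -powRrM natrM mulNr mulVf ?powR_inv1 //.
    by rewrite mulf_neq0 // pnatr_eq0 -lt0n.
  have Fxk : F ^+ k n <= x ^+ k n.
    rewrite -[x ^+ _]ger0_norm ?exprn_even_ge0 ?odd_even_log // normrX.
    by rewrite lerXn2r ?nnegrE // ltW.
  have bLb : c * v <= \prod_(z <- Lb) `|x - z|.
    by apply: cLb => // z; rewrite mem_filter => /andP[_ /xl].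
  have bLs : (eps / 2) ^+ size Ls <= \prod_(z <- Ls) `|x - z|.
    apply: prod_ge_exp => [|z]; first exact: ltW.
    rewrite mem_filter -ltNge => /andP[zB _].
    (* Here [|x| > rho + eps] while [|z| < rho + eps / 2]. *)
    have := lerB_dist x z; move: Fx zB; rewrite /F /B; clear; lra.
  apply: ler_pM => //; first exact: ltW.
    by rewrite mulr_ge0 ?invr_ge0 // ltW.
  rewrite Vx /kappa -vm.
  have cv0 : 0 <= c * v by rewrite mulr_ge0 // ltW.
  have eL0 : 0 <= (eps / 2) ^+ size Ls by rewrite exprn_ge0 // ltW.
  rewrite mulrAC -exprMn; apply: ler_pM; rewrite ?exprn_ge0 ?(ltW e2) //.
    by apply: lerXn2r; rewrite // nnegrE // (le_trans cv0).
  by apply: lerXn2r; rewrite // nnegrE // (le_trans eL0).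
have rS : cball rho 0 `<=` S'.
  by move=> z zr; left; rewrite /cball /= (le_trans zr) // lecR ltW.
have ek : ~~ odd (k n) by rewrite odd_even_log.
have Em := Eout_le (spec n Nn) (ltW r0) rS ek cV0 VC V0 Vlow.
have E0 : 0 <= Eout (M n) S'.
  by rewrite /Eout /expect big_seq sumr_ge0 // => A AM; rewrite mulr_ge0 // ltW // prob_gt0.
rewrite (ger0_norm E0) (le_trans _ (ler_norm _)) //.
have -> : kappa^-1 * (n%:R * U n) = kappa^-1 * n%:R * U n by rewrite mulrA.
have UE : U n = (shift_comb V (tau n) (k n) + n%:R * (rho ^+ k n * cV)) / F ^+ k n.
  rewrite mulrDl /U; congr (_ + _); rewrite expr_div_n.
  by move: (F ^+ k n)^-1 (rho ^+ k n) => ? ?; clear; ring.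
have Fn0 : 0 < F ^+ k n * (kappa * n%:R^-1) by rewrite mulr_gt0 // divr_gt0.
move: Em; rewrite -ler_pdivlMr // invfM invfM invrK UE => /le_trans; apply.
by rewrite [leRHS]mulrC -mulrA.
Unshelve. all: by end_near. Qed.

(* Choice of the constants *)
Local Close Scope complex_scope.

Theorem lemma2p5 (R : realType) (eps alpha Lambda0 Lambda1 : R)
    (eps_gt0 : 0 < eps) (alpha_gt0 : 0 < alpha)
    (Lambda0_gt0 : 0 < Lambda0) (Lambda0_lt1 : Lambda0 < Lambda1) :
  exists (r0 : nat) (theta0 : R),
    [/\ (0 < r0)%N, 0 < theta0 &
      forall (N : set nat) (M : forall n : nat, matrix_space R n)
             (r : nat) (c : nat -> nat -> R[i]),
        bounded_matrix_model Lambda0 Lambda1 N M ->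
        (r0 <= r)%N ->
        order_expansion Lambda0 Lambda1 N M r c ->
        forall theta : R, theta <= theta0 ->
          \forall n \near \oo, N n ->
            Eout (M n)
              (cball (Lambda0 + eps) 0 `|`
               cball_set (n%:R `^ (- theta)) (expansion_bases Lambda0 r c))
            <= n%:R `^ (- alpha)].
Proof.
pose a := Lambda0 + eps / 4; pose B := Lambda0 + eps / 2.
pose F := Lambda0 + eps; pose G := Lambda1 + 1.
have [a0 B0 F0] : [/\ 0 < a, 0 < B & 0 < F].
  by rewrite !addr_gt0 // divr_gt0.
have L1 : 0 < Lambda1 by rewrite (lt_trans Lambda0_gt0).
have G0 : 0 < G by rewrite addr_gt0.
have lG : Lambda1 < G by rewrite ltrDl.
have ra : Lambda0 < a by rewrite ltrDl divr_gt0.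
have lnFa : 0 < ln (F / a).
  by rewrite ln_gt0 // ltr_pdivlMr // mul1r /a /F; lra.
have lnBa : 0 < ln (B / a).
  by rewrite ln_gt0 // ltr_pdivlMr // mul1r /a /B; lra.
have ln_inv x y : 0 < x -> 0 < y -> ln (x / y) = - ln (y / x) :> R.
  by move=> x0 y0; rewrite -lnV ?posrE ?divr_gt0 // invf_div.
(* [C1] is the scale of the exponent for counting eigenvalues: it makes [(a / F)^k] of size
   [n ^ (- (alpha + 3))]. *)
pose C1 := (alpha + 3) / (2 * ln (F / a)).
have C10 : 0 < C1 by rewrite divr_gt0 ?addr_gt0 ?mulr_gt0.
have C1E : 2 * C1 * ln (a / F) = - (alpha + 3).
  rewrite ln_inv // /C1; field; exact: lt0r_neq0.
(* [m] orders suffice for [n ^ (- m)] to outweigh [(G / F)^k] at this scale. *)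
pose m := (Num.truncn (2 * C1 * ln (G / F) + (alpha + 3))).+1.
have mE : 2 * C1 * ln (G / F) - m%:R <= - (alpha + 3).
  have := truncnS_gt (2 * C1 * ln (G / F) + (alpha + 3)); rewrite -/m; lra.
(* A second scale, chosen after [m], serves the degree bound for bases of modulus at least [B]; [r1]
   is the order of expansion it needs. *)
pose C2 := m.+2%:R / (2 * ln (B / a)).
have C20 : 0 < C2 by rewrite divr_gt0 ?mulr_gt0.
have C2E : 2 * C2 * ln (a / B) = - m.+2%:R.
  rewrite ln_inv // /C2; field; exact: lt0r_neq0.
pose r1 := (Num.truncn (2 * C2 * ln (G / B) + m.+2%:R)).+1.
have r1E : 2 * C2 * ln (G / B) - r1%:R <= - m.+2%:R.
  have := truncnS_gt (2 * C2 * ln (G / B) + m.+2%:R); rewrite -/r1; lra.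
exists (maxn m r1), (2 * m%:R)^-1; split; first by rewrite leq_max.
  by rewrite invr_gt0 mulr_gt0 // ltr0n.
move=> N M r c model; rewrite geq_max => /andP[mr r1r] expn theta theta_le.
have [L [p [uL Lb real_expn]]] := order_expansion_real Lambda0_gt0 L1 expn.
have nz l : l \in L -> l != 0.
  by move=> /Lb[/andP[ll _] _]; rewrite -normr_gt0 (lt_trans Lambda0_gt0).
(* Both exponents decrease as [|l|] grows, so the constants computed at [B] work for every such
   base. *)
have deg i l : (i < m)%N -> l \in L -> B <= `|l| -> (size (p i l) <= 2 * m)%N.
  move=> im lL Bl; have l0 : 0 < `|l| by rewrite (lt_le_trans B0).
  have lnl x : 0 < x -> ln (x / `|l|) <= ln (x / B).
    move=> x0; rewrite ler_ln ?posrE ?divr_gt0 // ler_pM2l // lef_pV2 //.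
  have lnC x : 0 < x -> 2 * C2 * ln (x / `|l|) <= 2 * C2 * ln (x / B).
    by move=> x0; rewrite ler_wpM2l ?lnl // mulr_ge0 // ltW.
  have h1 : 2 * C2 * ln (a / `|l|) <= - m.+2%:R by rewrite -C2E lnC.
  have h2 : 2 * C2 * ln (G / `|l|) - r%:R <= - m.+2%:R.
    by apply: le_trans r1E; rewrite lerB ?lnC // ler_nat.
  have ir : (i < r)%N by exact: leq_trans im mr.
  have := base_degree_le Lambda0_gt0 ra G0 lG C20 model uL real_expn nz lL h1 h2 im ir.
  by move=> /leq_trans; apply; rewrite leq_mul2l.
have m0r : (0 < m <= r)%N by [].
have Ll l : l \in L -> Lambda0 < `|l| <= Lambda1 by move=> /Lb[].
have LS l : l \in L -> expansion_bases Lambda0 r c (real_complex R l) by move=> /Lb[].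
have C1E' : 2 * C1 * ln (a / F) <= - (alpha + 3) by rewrite C1E.
(* Taking the slack in [pow_bounded] to be 1 turns the exponent [- (alpha + 1)] into [- alpha]. *)
have := Eout_pow_bounded Lambda0_gt0 eps_gt0 G0 lG C10 m0r model uL real_expn Ll LS
  deg C1E' mE theta_le ltr01.
apply: filterS => n H Nn; apply: le_trans (ler_norm _) _.
by move: (H Nn); rewrite opprD subrK.
Qed.
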